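(* Let $\mathcal{H}$ be a real separable Hilbert space, let $C$ be a nonempty closed convex subset of $\mathcal{H}$, and let $f,g\in\Gamma_0(\mathcal{H})$, where $g$ is differentiable on $\mathcal{H}$ with a $\beta$-Lipschitz continuous gradient for some $\beta\in\,]0,+\infty[$. Suppose that the problem of minimizing $f+g$ over $C$ has a solution and that one of the following holds: (1) $C\cap\operatorname{int}\operatorname{dom}f\neq\varnothing$; (2) $\operatorname{dom}f\cap\operatorname{int}C\neq\varnothing$; (3) $\mathcal{H}$ is finite dimensional and $\operatorname{rint}C\cap\operatorname{rint}\operatorname{dom}f\neq\varnothing$. Let $(x_n)_{n\in\mathbb{N}}$ be generated by the nested algorithm described in the context (forward-backward iterations with at most $M_n\ge1$ inner Douglas-Rachford iterations at step $n$), with parameters as specified there. Then: (i) There exists a sequence of positive integers $(\overline{M}_n)_{n\in\mathbb{N}}$ such that, if $M_n\ge\overline{M}_n$ for every $n\in\mathbb{N}$, then $(x_n)_{n\in\mathbb{N}}$ converges weakly to a solution to the problem of minimizing $f+g$ over $C$. (ii) The sequence $(x_n)_{n\in\mathbb{N}}$ lies in $C$.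
   Context: $\Gamma_0(\mathcal{H})$ denotes the class of lower semicontinuous convex functions from $\mathcal{H}$ to $]-\infty,+\infty]$ that are proper (not identically $+\infty$). $\operatorname{dom}f=\{x\mid f(x)<+\infty\}$; $\operatorname{int}S$ and $\operatorname{rint}S$ are the interior and relative interior of $S$. $P_C$ is the projection onto $C$, and for $h\in\Gamma_0(\mathcal{H})$, $\operatorname{prox}_h x=\arg\min_{y\in\mathcal{H}}\frac12\|y-x\|^2+h(y)$. Algorithm. Parameters: a sequence $(\gamma_n)_{n\in\mathbb{N}}$ with $0<\inf_{n}\gamma_n\le\sup_n\gamma_n<2\beta^{-1}$; a sequence $(\lambda_n)_{n\in\mathbb{N}}$ and a constant $\underline{\lambda}$ with $0<\underline{\lambda}\le\lambda_n\le1$ for every $n$; a constant $\underline{\tau}\in\,]0,2]$; reals $\tau_{n,m}\in[\underline{\tau},2]$; integers $M_n\ge1$. Initialization: $x_0\in C$. For $n=0,1,2,\ldots$: - set $x_n'=x_n-\gamma_n\nabla g(x_n)$; - set $z_{n,0}=2\operatorname{prox}_{\gamma_nf}x_n'-x_n'$; - for $m=0,\ldots,M_n-1$, compute $$z_{n,m+\frac12}=P_C\Big(\frac{z_{n,m}+x_n'}{2}\Big),\qquad z_{n,m+1}=z_{n,m}+\tau_{n,m}\big(\operatorname{prox}_{\gamma_nf}(2z_{n,m+\frac12}-z_{n,m})-z_{n,m+\frac12}\big),$$ and leave this inner loop as soon as $z_{n,m+1}=z_{n,m}$; - let $m_n\in\{0,\ldots,M_n-1\}$ be the last value of $m$ performed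 in the inner loop (so either the loop was left because $z_{n,m_n+1}=z_{n,m_n}$, or $m_n=M_n-1$), and set $x_{n+1}=x_n+\lambda_n\big(z_{n,m_n+\frac12}-x_n\big)$. *)

(* Defs.v *)
From HB Require Import structures.
From mathcomp Require Export all_boot all_order all_algebra.
From mathcomp Require Export all_classical all_reals all_analysis.
Export numFieldNormedType.Exports.

Set Implicit Arguments.
Unset Strict Implicit.
Unset Printing Implicit Defensive.

Import Order.TTheory GRing.Theory Num.Theory.

Local Open Scope classical_set_scope.
Local Open Scope ring_scope.

(* A real Hilbert space is a completeNormedModType [H] over a realType together
   with a positive definite symmetric form [ip : {dot H for idfun}] that induces
   its norm. *)
Definition induces_norm (R : realType) (H : normedModType R)
    (ip : {dot H for (@idfun R)}) : Prop :=
  forall x, ip x x = `|x| ^+ 2.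

Definition separable_space (T : topologicalType) : Prop :=
  exists2 D : set T, countable D & dense D.

Definition finite_dimensional (R : realType) (V : lmodType R) : Prop :=
  exists (n : nat) (e : 'I_n -> V),
    forall x, exists a : 'I_n -> R, x = \sum_(i < n) a i *: e i.

Definition affine_hull (R : realType) (V : lmodType R) (S : set V) : set V :=
  [set x | exists (n : nat) (a : 'I_n -> R) (s : 'I_n -> V),
    [/\ forall i, S (s i), \sum_(i < n) a i = 1
      & x = \sum_(i < n) a i *: s i]].

(* Interior of [S] for the topology induced on its affine hull. *)
Definition rint (R : realType) (V : normedModType R) (S : set V) : set V :=
  [set x | S x /\ \forall y \near x, affine_hull S y -> S y].

Section ExtendedRealFunctions.
Variables (R : realType) (H : normedModType R).

Definition dom (f : H -> \bar R) : set H := [set x | (f x < +oo)%E].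

Definition convex_efun (f : H -> \bar R) : Prop :=
  forall (x y : H) (t : R), 0 < t < 1 ->
    (f (t *: x + (1 - t) *: y)%R <= t%:E * f x + (1 - t)%:E * f y)%E.

Definition Gamma0 (f : H -> \bar R) : Prop :=
  [/\ forall x, (-oo < f x)%E, dom f !=set0,
      convex_efun f & lower_semicontinuous f].

Definition is_minimizer (C : set H) (F : H -> \bar R) (x : H) : Prop :=
  C x /\ forall y, C y -> (F x <= F y)%E.

(* [prox] and [proj] are made total by returning 0 when there is no minimizer;
   for [h] in Gamma0 and [C] nonempty closed convex in a Hilbert space the
   minimizer exists and is unique. *)
Definition prox (h : H -> \bar R) (x : H) : H :=
  xget 0 (is_minimizer setT (fun y => ((2^-1 * `|y - x| ^+ 2)%:E + h y)%E)).

Definition proj (C : set H) (x : H) : H :=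
  xget 0 [set p | C p /\ forall y, C y -> `|x - p| <= `|x - y|].

End ExtendedRealFunctions.

Section InnerProduct.
Variables (R : realType) (H : normedModType R) (ip : {dot H for (@idfun R)}).

Definition is_gradient (g : H -> R) (dg : H -> H) : Prop :=
  forall x, differentiable g x /\ forall h, 'd g x h = ip (dg x) h.

Definition weakly_converges (x : nat -> H) (l : H) : Prop :=
  forall v, ip (x n) v @[n --> \oo] --> ip l v.

End InnerProduct.

Section NestedAlgorithm.
Variables (R : realType) (H : normedModType R).
Variables (C : set H) (f : H -> \bar R) (dg : H -> H).
Variables (gamma lambda : nat -> R) (tau : nat -> nat -> R).

(* One outer step, producing [xn1] from [xn] with at most [Mn] inner steps:
   [z m] stands for z_{n,m} and [zh m] for z_{n,m+1/2}; [mn] is the last inner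
   index performed, and only the values computed by the loop are constrained. *)
Definition outer_step (n Mn : nat) (xn xn1 : H) : Prop :=
  let xn' := xn - gamma n *: dg xn in
  let P := prox (fun y => ((gamma n)%:E * f y)%E) in
  exists (z zh : nat -> H) (mn : nat),
    [/\ (mn < Mn)%N,
        z 0%N = 2 *: P xn' - xn',
        forall m, (m <= mn)%N ->
          zh m = proj C (2^-1 *: (z m + xn')) /\
          z m.+1 = z m + tau n m *: (P (2 *: zh m - z m) - zh m),
        (forall m, (m < mn)%N -> z m.+1 <> z m) /\
        (z mn.+1 = z mn \/ mn = Mn.-1)
      & xn1 = xn + lambda n *: (zh mn - xn)].

Definition nested_sequence (x0 : H) (M : nat -> nat) (x : nat -> H) : Prop :=
  x 0%N = x0 /\ forall n, outer_step n (M n) (x n) (x n.+1).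

End NestedAlgorithm.

(* Main.v *)
From HB Require Import structures.
From mathcomp Require Import ring lra.
Require Import Defs.

Set Implicit Arguments.
Unset Strict Implicit.
Unset Printing Implicit Defensive.

Import Order.TTheory GRing.Theory Num.Theory.

Local Open Scope classical_set_scope.
Local Open Scope ring_scope.

(** The inner loop is Douglas-Rachford splitting for the problem of minimizing
    [gamma_n f + |. - x'|^2 / 2] over [C], whose solution [p] is the exact
    forward-backward point; the outer loop is then a forward-backward iteration
    with errors. If the n-th error is at most [2^-n] whatever the current point of a
    fixed ball, the iterates never leave that ball, and the classical argument
    applies: [inexact_step] makes the distances to solutions converge,
    [forward_backward_fejer] (which rests on the cocoercivity of the gradient,
    [gradient_cocoercive]) makes the residuals vanish, a monotonicity argument in
    the style of Minty shows that weak cluster points are solutions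
    ([weak_limit_optimal]), and the lemma of Opial ([opial]) concludes.

    The bound on the number of inner steps is chosen before the sequence is known.
    Hence the inner loop has to converge uniformly over balls of base points
    ([relaxed_uniform], [outer_step_uniform]), and this although the relaxation
    parameters may be equal to 2, in which case the governing sequence need not
    converge even in finite dimension. With [z] the governing sequence and [S] its
    shadow, two facts make the unrelaxed iteration uniform. First, the quadratic
    is strongly convex, so the squared errors of the shadow are summable, with a sum
    bounded by the squared distance from the start to a fixed point
    ([reflect_fejer]). Second, the Douglas-Rachford envelope increases by a square
    at each step and is bounded by the optimal value ([envelope_increase],
    [envelope_le], [envelope_ge]). Together they bound the sum of the squares
    [|z_(m+2) - z_m|^2]; these are nonincreasing, hence of order [1 / m]
    ([diff_rate]), and Fejer monotonicity over two steps transfers a rate to the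
    error of the shadow ([shadow_rate]). For general parameters, either the defects
    from 2 have an infinite sum, and the ordinary residuals vanish uniformly, or
    they are summable, and the iteration is a small perturbation of the unrelaxed
    one.

    Fixed points at a bounded distance come from multipliers. They are limits of the
    multipliers of penalized problems ([multiplier_of_bound]), which converge
    strongly as soon as they are bounded, and the constraint qualification serves
    only to bound them ([qualification_regular]): by the uniform boundedness
    principle if one of the interiors is involved, by an orthonormal basis of the
    relevant subspace in finite dimension. *)

(** * Inner product algebra *)

Section InnerProductAlgebra.
Context {R : realType} {H : normedModType R} (ip : {dot H for (@idfun R)}).
Implicit Types (x y z : H) (a : R).

Lemma ipC x y : ip x y = ip y x.
Proof. by have := hermC ip x y; rewrite expr0 mul1r. Qed.
Lemma ipDl x y z : ip (x + y) z = ip x z + ip y z.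
Proof. exact: (linearDl ip). Qed.
Lemma ipDr x y z : ip z (x + y) = ip z x + ip z y.
Proof. exact: (linearDr ip). Qed.
Lemma ipNl x z : ip (- x) z = - ip x z.
Proof. exact: (linearNl ip). Qed.
Lemma ipNr x z : ip z (- x) = - ip z x.
Proof. exact: (linearNr ip). Qed.
Lemma ipZl a x z : ip (a *: x) z = a * ip x z.
Proof. exact: (linearZl_LR ip). Qed.
Lemma ipZr a x z : ip z (a *: x) = a * ip z x.
Proof. exact: (linearZr_LR ip). Qed.
Lemma ip0l z : ip 0 z = 0.
Proof. exact: (linear0l ip). Qed.
Lemma ip0r z : ip z 0 = 0.
Proof. exact: (linear0r ip). Qed.
Definition ipE := (ipDl, ipDr, ipNl, ipNr, ipZl, ipZr, ip0l, ip0r).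

End InnerProductAlgebra.

(* Symmetry is oriented by whichever of the two products is met first, so that
   each unordered pair of vectors becomes a single atom. *)
Ltac ip_sym ip :=
  repeat match goal with
  | |- context [Dot.sort ip ?a ?b] =>
    match goal with
    | |- context [Dot.sort ip b a] =>
      tryif constr_eq a b then fail else rewrite (ipC ip b a)
    end
  end.

Ltac ip_expand ip := rewrite ?(ipE ip); ip_sym ip.

Section InnerProductNorm.
Context {R : realType} {H : normedModType R} (ip : {dot H for (@idfun R)}).
Hypothesis ip_norm : induces_norm ip.
Implicit Types x y z : H.

Lemma ip_le_norm x y : ip x y <= `|x| * `|y|.
Proof.
have [x0|x0] := eqVneq `|x| 0.
  by rewrite (normr0_eq0 x0) ip0l normr0 mul0r.
have [y0|y0] := eqVneq `|y| 0.
  by rewrite (normr0_eq0 y0) ip0r normr0 mulr0.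
have := sqr_ge0 `| `|y| *: x - `|x| *: y |.
rewrite -ip_norm; ip_expand ip; rewrite !ip_norm => h.
have xy_gt0 : 0 < `|x| * `|y| by rewrite mulr_gt0 // lt0r ?x0 ?y0 /=.
rewrite -(ler_pM2l xy_gt0); nra.
Qed.

Lemma norm_ip_le x y : `|ip x y| <= `|x| * `|y|.
Proof.
rewrite ler_norml ip_le_norm andbT lerNl -(ipNl ip).
by rewrite (le_trans (ip_le_norm _ _)) ?normrN.
Qed.

Lemma ip_eq0_norm x : ip x x <= 0 -> x = 0.
Proof.
rewrite ip_norm => x0; apply: normr0_eq0; apply/eqP.
by rewrite -sqrf_eq0 eq_le x0 sqr_ge0.
Qed.

Lemma ip_vec_eq x y : ip (x - y) (x - y) = 0 -> x = y.
Proof.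
by move=> xy0; apply/eqP; rewrite -subr_eq0; apply/eqP/ip_eq0_norm; rewrite xy0.
Qed.

Lemma ip_ext x y : (forall w, ip x w = ip y w) -> x = y.
Proof. by move=> h; apply: ip_vec_eq; rewrite ipDl ipNl h subrr. Qed.

Lemma ip_cvg (T : Type) (F : set_system T) {FF : Filter F} (u v : T -> H) a b :
  u @ F --> a -> v @ F --> b -> (fun t => ip (u t) (v t)) @ F --> ip a b.
Proof.
move=> ua vb.
suff polar x y : ip x y = 2^-1 * (`|x + y| ^+ 2 - `|x| ^+ 2 - `|y| ^+ 2).
  rewrite polar; under eq_fun do rewrite polar.
  by apply: cvgM; [exact: cvg_cst|]; apply: cvgB; [apply: cvgB|];
    rewrite ?expr2; apply: cvgM; apply: cvg_norm => //; exact: cvgD.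
rewrite -!ip_norm; ip_expand ip; lra.
Qed.

End InnerProductNorm.

(** Conclusions about a direction are drawn from small steps along it; this
    removes the second-order term such steps leave. *)
Lemma le_of_small_perturbation (R : realType) (a b c : R) :
  (forall t, 0 < t < 1 -> a <= b + t * c) -> a <= b.
Proof.
move=> h; rewrite leNgt; apply/negP => ba.
pose t := Num.min (2^-1) ((a - b) / (2 * (`|c| + 1))).
have c1 : 0 < 2 * (`|c| + 1) by rewrite mulr_gt0 ?ltr_wpDl.
have t0 : 0 < t by rewrite lt_min invr_gt0 ltr0n/= divr_gt0 ?subr_gt0.
have t1 : t < 1 by rewrite gt_min invf_lt1 ?ltr1n.
have tc : t * (2 * (`|c| + 1)) <= a - b.
  by rewrite -ler_pdivlMr// ge_min lexx orbT.
have := h t; rewrite t0 t1 => /(_ isT).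
have := ler_norm c; nra.
Qed.

(* An identity between linear combinations of vectors is tested against an
   arbitrary vector, which turns it into an identity between scalars. *)
Ltac vec ip ip_norm :=
  apply: (ip_ext ip_norm); let w := fresh "w" in
  move=> w; rewrite ?(ipE ip); by [ring|field].

(** * Subgradients and proximal points *)

Section Subgradients.
Context {R : realType} {H : completeNormedModType R} (ip : {dot H for (@idfun R)}).
Hypothesis ip_norm : induces_norm ip.
Implicit Types (x y z p q u v w : H) (h : H -> \bar R).

Definition subgradient h p w : Prop :=
  h p \is a fin_num /\ forall y, (h p + (ip w (y - p))%:E <= h y)%E.

Lemma subgradient_fine h p w y : subgradient h p w -> h y \is a fin_num ->
  fine (h p) + ip w (y - p) <= fine (h y).
Proof.
by move=> [/fineK hp hw] /fineK hy; have := hw y;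
  rewrite -hp -hy -EFinD lee_fin.
Qed.

Lemma subgradient_monotone h p q u v :
  subgradient h p u -> subgradient h q v -> 0 <= ip (u - v) (p - q).
Proof.
move=> hp hq; have := subgradient_fine hp hq.1.
have := subgradient_fine hq hp.1; ip_expand ip; lra.
Qed.

Lemma Gamma0_fin h y : Gamma0 h -> dom h y -> h y \is a fin_num.
Proof. by move=> [h0 _ _ _] hy; rewrite fin_real// h0. Qed.

Lemma Gamma0_convex_fine h x y t : Gamma0 h -> dom h x -> dom h y ->
  0 < t < 1 -> dom h (t *: x + (1 - t) *: y) /\
  fine (h (t *: x + (1 - t) *: y)) <= t * fine (h x) + (1 - t) * fine (h y).
Proof.
move=> h0 hx hy t01; have [hoo _ hc _] := h0.
have := hc x y t t01.
rewrite -[h x]fineK ?Gamma0_fin// -[h y]fineK ?Gamma0_fin// -!EFinM -EFinD => hle.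
have hd : dom h (t *: x + (1 - t) *: y) by rewrite /dom/= (le_lt_trans hle) ?ltry.
split=> //; move: hle.
by rewrite -{1}[h (_ + _)]fineK ?Gamma0_fin// lee_fin.
Qed.

(** Convexity turns the lower bound that semicontinuity gives on a ball around
    [y0] into a bound of linear growth, by contracting each point towards [y0]. *)
Lemma Gamma0_minorant h : Gamma0 h ->
  exists y0 a b, 0 <= b /\ forall y, ((a - b * `|y - y0|)%:E <= h y)%E.
Proof.
move=> h0; have [hoo [y0 hy0] hc hl] := h0.
have fy0 := Gamma0_fin h0 hy0.
have [|V /nbhs_ballP[r /= r0 rV] hV] := hl y0 (fine (h y0) - 1).
  by rewrite -[X in (_ < X)%E]fineK// lte_fin; lra.
exists y0, (fine (h y0) - 1), (2 / r); split; first by rewrite divr_ge0// ltW.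
move=> y; have [hy|hy] := ltP (h y) +oo%E; last first.
  by rewrite (le_trans _ hy)// leey.
have fy := Gamma0_fin h0 hy.
rewrite -[h y]fineK// lee_fin.
have lower z : `|y0 - z| < r -> dom h z -> fine (h y0) - 1 < fine (h z).
  move=> zr hz; rewrite -lte_fin fineK ?Gamma0_fin//; apply/hV/rV.
  by rewrite -ball_normE.
have [yr|yr] := ltP `|y - y0| r.
  rewrite distrC in yr; have := lower y yr hy.
  have : 0 <= 2 / r * `|y - y0| by rewrite mulr_ge0// divr_ge0// ltW.
  lra.
set d := `|y - y0| in yr *; have d0 : 0 < d by exact: lt_le_trans yr.
(* The contracted point is at distance [r / 2] of [y0]. *)
pose t := r / (2 * d).
have td : 2 * t * d = r by rewrite /t; field; rewrite gt_eqF.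
have t0 : 0 < t by rewrite divr_gt0// mulr_gt0.
have t1 : t < 1.
  by rewrite ltr_pdivrMr ?mulr_gt0// mul1r; lra.
have [hz hzle] := @Gamma0_convex_fine h y y0 t h0 hy hy0 ltac:(by rewrite t0 t1).
have zr : `|y0 - (t *: y + (1 - t) *: y0)| < r.
  have -> : y0 - (t *: y + (1 - t) *: y0) = - t *: (y - y0).
    by vec ip ip_norm.
  by rewrite normrZ normrN gtr0_norm// -/d; nra.
have := lower _ zr hz => lo.
have key : t * (fine (h y0) - fine (h y)) <= 1 by lra.
have -> : 2 / r = (t * d)^-1 by rewrite -td; field; rewrite !gt_eqF.
have -> : (t * d)^-1 * d = t^-1 by field; rewrite !gt_eqF.
have : fine (h y0) - fine (h y) <= t^-1.
  by rewrite -[t^-1]mul1r ler_pdivlMr// mulrC.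
lra.
Qed.

End Subgradients.

Lemma cauchy_of_sqr_dist {R : realType} {H : completeNormedModType R}
    (u : nat -> H) (e : nat -> R) :
  e @ \oo --> 0 -> (forall n k, `|u n - u k| ^+ 2 <= e n + e k) -> cvgn u.
Proof.
move=> e0 ue; apply/cauchy_cvgP; apply/cauchy_ballP => eps eps0; near_simpl.
have d0 : 0 < eps ^+ 2 / 2 by rewrite divr_gt0 ?exprn_gt0.
near=> n m => /=; rewrite -ball_normE /=.
rewrite -(@ltr_pXn2r _ 2)// ?nnegrE ?normr_ge0 ?(ltW eps0)//.
apply: (le_lt_trans (ue _ _)).
have small k : `|0 - e k| < eps ^+ 2 / 2 -> e k < eps ^+ 2 / 2.
  by rewrite sub0r normrN; apply: le_lt_trans; exact: ler_norm.
have En : e n < eps ^+ 2 / 2.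
  by apply: small; near: n; move/cvgrPdist_lt : e0; exact.
have Em : e m < eps ^+ 2 / 2.
  by apply: small; near: m; move/cvgrPdist_lt : e0; exact.
lra.
Unshelve. all: end_near. Qed.

Section Prox.
Context {R : realType} {H : completeNormedModType R} (ip : {dot H for (@idfun R)}).
Hypothesis ip_norm : induces_norm ip.
Implicit Types (x y z p q u v w : H) (h : H -> \bar R).

(** By the parallelogram identity, the quadratic term makes every minimizing
    sequence Cauchy; semicontinuity shows that its limit is a minimizer. *)
Lemma prox_exists h x : Gamma0 h -> exists p,
  is_minimizer setT (fun y => ((2^-1 * `|y - x| ^+ 2)%:E + h y)%E) p.
Proof.
move=> h0; have [hoo [yd hyd] hc hl] := h0.
pose Phi y := 2^-1 * `|y - x| ^+ 2 + fine (h y).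
pose S := [set Phi y | y in dom h].
have [y0 [a [b [b0 hmin]]]] := Gamma0_minorant ip_norm h0.
have hmin' y : dom h y -> a - b * `|y - y0| <= fine (h y).
  by move=> hy; rewrite -lee_fin fineK ?Gamma0_fin.
have Sinf : has_inf S.
  split; first by exists (Phi yd); exists yd.
  exists (a - b * `|x - y0| - 2^-1 * b ^+ 2) => _ [y hy <-].
  have := hmin' y hy; rewrite /Phi.
  have := ler_wpM2l b0 (ler_distD x y y0).
  have := sqr_ge0 (`|y - x| - b); lra.
have /choice[y_ y_P] n : exists y, dom h y /\ Phi y < inf S + n.+1%:R^-1.
  have [|_ [y hy <-] lt] := @inf_adherent R S n.+1%:R^-1 _ Sinf.
    by rewrite invr_gt0.
  by exists y.
have infS y : dom h y -> inf S <= Phi y by move=> hy; apply: ge_inf; [exact: Sinf.2|exists y].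
have cvgy : cvgn y_.
  apply: (@cauchy_of_sqr_dist _ _ _ (fun n => 4 * n.+1%:R^-1)).
    by rewrite -[X in _ --> X](mulr0 4); apply: cvgM; [exact: cvg_cst|exact: cvg_harmonic].
  move=> n k; have [hn ln] := y_P n; have [hk lk] := y_P k.
  have half : 0 < (2^-1 : R) < 1 by rewrite invr_gt0 ltr0n invf_lt1 ?ltr1n.
  have [hm lm] := Gamma0_convex_fine h0 hn hk half.
  have := infS _ hm.
  have -> : Phi (2^-1 *: y_ n + (1 - 2^-1) *: y_ k)
    = 2^-1 * (2^-1 * `|y_ n - x| ^+ 2 + 2^-1 * `|y_ k - x| ^+ 2
              - 4^-1 * `|y_ n - y_ k| ^+ 2)
      + fine (h (2^-1 *: y_ n + (1 - 2^-1) *: y_ k)).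
    by rewrite /Phi; congr (_ + _); rewrite -!ip_norm; ip_expand ip; field.
  move: lm ln lk; rewrite /Phi /=; move: (n.+1%:R^-1) (k.+1%:R^-1) => en ek; lra.
pose p := limn y_.
have Phim : Phi (y_ n) @[n --> \oo] --> inf S.
  apply: (@squeeze_cvgr _ _ _ _ (cst (inf S)) (fun n => inf S + n.+1%:R^-1)).
  - by apply: nearW => n; have [hn /ltW ->] := y_P n; rewrite infS.
  - exact: cvg_cst.
  - by rewrite -[X in _ --> X]addr0; apply: cvgD; [exact: cvg_cst|exact: cvg_harmonic].
have dist_cvg : 2^-1 * `|y_ n - x| ^+ 2 @[n --> \oo] --> 2^-1 * `|p - x| ^+ 2.
  apply: cvgM; first exact: cvg_cst.
  by rewrite !expr2; apply: cvgM; apply: cvg_norm; apply: cvgB => //; exact: cvg_cst.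
have hple : (h p <= (inf S - 2^-1 * `|p - x| ^+ 2)%:E)%E.
  rewrite leNgt; apply/negP => hpgt.
  have [c rc /hl[V pV hV]] : exists2 c, inf S - 2^-1 * `|p - x| ^+ 2 < c & (c%:E < h p)%E.
    move: hpgt; case: (h p) => [r||//].
      rewrite lte_fin => rr; exists ((inf S - 2^-1 * `|p - x| ^+ 2 + r) / 2);
        last rewrite lte_fin; lra.
    by move=> _; exists (inf S - 2^-1 * `|p - x| ^+ 2 + 1); [lra|rewrite ltry].
  suff : 2^-1 * `|p - x| ^+ 2 + c <= inf S by lra.
  apply: (ler_cvg_to (cvgD dist_cvg (cvg_cst c)) Phim).
  near=> n; rewrite /Phi lerD2l// -lee_fin fineK; last first.
    by apply: Gamma0_fin => //; exact: (y_P n).1.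
  apply/ltW/hV; near: n; exact: cvgy.
exists p; split=> // y _.
have hp : dom h p by rewrite /dom/= (le_lt_trans hple) ?ltry.
have [hy|hy] := ltP (h y) +oo%E; last first.
  by move: hy; rewrite leye_eq => /eqP ->; rewrite addey// leey.
have fy := Gamma0_fin h0 hy; have fp := Gamma0_fin h0 hp.
move: hple; rewrite -[h p]fineK// -[h y]fineK// -!EFinD !lee_fin.
by have := infS y hy; rewrite /Phi; lra.
Unshelve. all: end_near. Qed.

(** The inequality is the first-order term of optimality along the segment from
    [p] to [y]. *)
Lemma minimizer_subgradient h x p : Gamma0 h ->
  is_minimizer setT (fun y => ((2^-1 * `|y - x| ^+ 2)%:E + h y)%E) p ->
  subgradient ip h p (x - p).
Proof.
move=> h0 [_ pmin]; have [_ [yd hyd] _ _] := h0.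
have hp : dom h p.
  rewrite /dom/= ltNge leye_eq; apply/negP => /eqP hp.
  have := pmin yd I; rewrite hp addey// leye_eq -[h yd]fineK ?Gamma0_fin//.
have fp := Gamma0_fin h0 hp; split=> // y.
have [hy|hy] := ltP (h y) +oo%E; last first.
  by move: hy; rewrite leye_eq => /eqP ->; rewrite leey.
have fy := Gamma0_fin h0 hy.
rewrite -[h p]fineK// -[h y]fineK// -EFinD lee_fin.
apply: (@le_of_small_perturbation _ _ _ (2^-1 * `|y - p| ^+ 2)) => t t01.
have [hz hzle] := Gamma0_convex_fine h0 hy hp t01.
have := pmin (t *: y + (1 - t) *: p) I.
rewrite -[h p]fineK// -[h (_ + _)]fineK ?Gamma0_fin// -!EFinD lee_fin.
move=> hle; have t0 : 0 < t by case/andP: t01.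
rewrite -(ler_pM2l t0).
move: hle; rewrite -!ip_norm; ip_expand ip; lra.
Qed.

Lemma prox_subgradient h x : Gamma0 h -> subgradient ip h (prox h x) (x - prox h x).
Proof.
move=> h0; apply: minimizer_subgradient => //; rewrite /prox.
by apply: xgetPex; exact: prox_exists.
Qed.

(** Firm nonexpansiveness of the resolvent is monotonicity in disguise. *)
Lemma subgradient_firm h x y p q : subgradient ip h p (x - p) ->
  subgradient ip h q (y - q) -> `|p - q| ^+ 2 <= ip (x - y) (p - q).
Proof.
move=> hp hq; have := subgradient_monotone hp hq.
by rewrite -ip_norm; ip_expand ip; lra.
Qed.

Lemma subgradient_unique h x p q : subgradient ip h p (x - p) ->
  subgradient ip h q (x - q) -> p = q.
Proof.
move=> hp hq; have := subgradient_firm hp hq.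
rewrite subrr ip0l -ip_norm => /(ip_eq0_norm ip_norm)/eqP.
by rewrite subr_eq0 => /eqP.
Qed.

Lemma firm_nonexpansive x y p q : `|p - q| ^+ 2 <= ip (x - y) (p - q) -> `|p - q| <= `|x - y|.
Proof.
move=> h; have := le_trans h (ip_le_norm ip_norm _ _).
have := normr_ge0 (p - q); rewrite le0r => /orP[/eqP->//|p0].
by rewrite expr2 ler_pM2r.
Qed.

Lemma prox_nonexpansive h x y : Gamma0 h -> `|prox h x - prox h y| <= `|x - y|.
Proof.
by move=> h0; apply: firm_nonexpansive; apply: subgradient_firm; exact: prox_subgradient.
Qed.

Lemma Gamma0_scale h c : 0 < c -> Gamma0 h -> Gamma0 (fun y => (c%:E * h y)%E).
Proof.
move=> c0 [hoo [y hy] hc hl].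
have cpos : (0 < c%:E)%E by rewrite lte_fin.
have scale_le a b : (c%:E * a <= c%:E * b)%E = (a <= b)%E.
  exact: (lee_pmul2l (erefl : c%:E \is a fin_num) cpos).
have scale_lt r z : (r%:E < c%:E * h z)%E = ((c^-1 * r)%:E < h z)%E.
  by rewrite EFinM lte_pdivrMl.
split.
- move=> x; move: (hoo x); case: (h x) => [r||]//= _; first by rewrite ltNyr.
  by rewrite gt0_muley ?lte_fin.
- exists y; move: hy (hoo y); rewrite /dom/=; case: (h y) => [r||]//= _ _; by rewrite ltry.
- move=> x z t t01; have := hc x z t t01; rewrite -scale_le.
  move=> h1; apply: (le_trans h1).
  case/andP: t01 => t0 t1; have t1' : 0 < 1 - t by rewrite subr_gt0.
  move: (hoo x) (hoo z); case: (h x) => [r||]//=; case: (h z) => [r'||]//= _ _.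
  + by rewrite lee_fin; lra.
  + by rewrite !gt0_muley ?lte_fin// addey//= gt0_muley ?lte_fin// leey.
  + by rewrite !gt0_muley ?lte_fin// addye//= gt0_muley ?lte_fin// leey.
  + by rewrite !gt0_muley ?lte_fin// addye//= gt0_muley ?lte_fin// leey.
- move=> x a; rewrite scale_lt => /hl[V xV hV]; exists V => // z /hV.
  by rewrite scale_lt.
Qed.

Lemma subgradient_scale h c p w : 0 < c ->
  subgradient ip (fun y => (c%:E * h y)%E) p w -> subgradient ip h p (c^-1 *: w).
Proof.
move=> c0 [fp pmin]; have cpos : (0 < c%:E)%E by rewrite lte_fin.
have scale_le a b : (c%:E * a <= c%:E * b)%E = (a <= b)%E.
  exact: (lee_pmul2l (erefl : c%:E \is a fin_num) cpos).
have fhp : h p \is a fin_num.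
  by move: fp; case: (h p) => [r||]//=; rewrite ?gt0_muley ?gt0_muleNy ?lte_fin.
split=> // y; rewrite -scale_le; apply: (le_trans _ (pmin y)); rewrite -[h p]fineK//.
by rewrite lee_fin ipZl mulrDr mulrA divff ?gt_eqF// mul1r.
Qed.

(** * Projections and normal cones *)

Definition indicator (C : set H) y : \bar R := if `[< C y >] then 0%E else +oo%E.

Definition normal_cone (C : set H) p w := C p /\ forall y, C y -> ip w (y - p) <= 0.

Lemma convex_setP (C : set H) x y t : convex_set C -> C x -> C y -> 0 < t < 1 ->
  C (t *: x + (1 - t) *: y).
Proof.
move=> Cc Cx Cy /andP[t0 t1].
have t01 : Itv.spec (@Itv.num_sem R) (Itv.Real `[0%Z, 1%Z]) t.
  by rewrite /Itv.spec/= /Itv.num_sem /= in_itv/= !ltW// ger0_real ?ltW.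
have := Cc x y (Itv.mk t01); rewrite !inE => /(_ Cx Cy).
by rewrite /conv/=.
Qed.

Lemma Gamma0_indicator (C : set H) : C !=set0 -> closed C -> convex_set C ->
  Gamma0 (indicator C).
Proof.
move=> [c Cc] Ccl Ccv; split.
- by move=> x; rewrite /indicator; case: asboolP.
- by exists c; rewrite /dom/= /indicator; case: asboolP.
- move=> x y t t01; rewrite /indicator.
  case/andP: (t01) => t0 t1; have t1' : 0 < 1 - t by rewrite subr_gt0.
  case: (asboolP (C x)) => [Cx|_]; case: (asboolP (C y)) => [Cy|_].
  + by case: asboolP => [_|[]]; rewrite ?mule0 ?adde0//; exact: convex_setP.
  + by rewrite mule0 add0e gt0_muley ?lte_fin// leey.
  + by rewrite mule0 adde0 gt0_muley ?lte_fin// leey.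
  + by rewrite !gt0_muley ?lte_fin// leey.
- move=> x a; rewrite /indicator; case: (asboolP (C x)) => Cx ax.
    exists setT; first exact: filterT.
    by move=> y _; case: asboolP => // _; rewrite ltry.
  exists (~` C); first by apply: open_nbhs_nbhs; split; [exact: closed_openC|].
  by move=> y; case: asboolP => // _ _; rewrite ltry.
Qed.

(** Minimizing the half squared distance gives a nearest point [p] with the
    variational inequality; that inequality forces any other nearest point, in
    particular the one that [proj] selects, to be [p]. *)
Lemma proj_normal_cone (C : set H) x : C !=set0 -> closed C -> convex_set C ->
  normal_cone C (proj C x) (x - proj C x).
Proof.
move=> C0 Ccl Ccv.
have [] := prox_subgradient x (Gamma0_indicator C0 Ccl Ccv).
set p := prox _ x; rewrite /indicator; case: asboolP => // Cp _ pmin.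
have pn y : C y -> ip (x - p) (y - p) <= 0.
  by move=> Cy; have := pmin y; case: asboolP => // _; rewrite add0e lee_fin.
have [pC pbest] : C p /\ forall y, C y -> `|x - p| <= `|x - y|.
  split=> // y Cy; rewrite -(@ler_pXn2r _ 2) ?nnegrE//.
  have := pn y Cy; have := sqr_ge0 `|y - p|; rewrite -!ip_norm; ip_expand ip; lra.
have [qC qbest] : [set p | C p /\ forall y, C y -> `|x - p| <= `|x - y|] (proj C x).
  by rewrite /proj; apply: xgetPex; exists p.
suff -> : proj C x = p by [].
apply: (ip_vec_eq ip_norm).
have := qbest p pC; rewrite -(@ler_pXn2r _ 2) ?nnegrE//.
have := pn _ qC; set q := proj C x => h1 h2.
apply/eqP; rewrite eq_le ip_norm sqr_ge0 andbT; move: h1 h2.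
by rewrite -!ip_norm; ip_expand ip; lra.
Qed.

Lemma normal_cone_monotone C p q u v :
  normal_cone C p u -> normal_cone C q v -> 0 <= ip (u - v) (p - q).
Proof.
move=> [Cp hp] [Cq hq]; have := hp q Cq; have := hq p Cp.
by ip_expand ip; lra.
Qed.

End Prox.

(** * Multipliers by penalization *)

Lemma contraction_fixpoint {R : realType} {H : completeNormedModType R}
    (T : H -> H) (k : R) : 0 <= k < 1 ->
  (forall x y, `|T x - T y| <= k * `|x - y|) -> exists p, p = T p.
Proof.
move=> /andP[k0 k1] Tk.
have Tfun : set_fun [set: H] [set: H] T by [].
pose F : {fun [set: H] >-> [set: H]} := HB.pack T (isFun.Build _ _ _ _ _ Tfun).
have ctr : is_contraction F.
  exists (NngNum k0); split=> //= -[x y] _ /=; exact: Tk.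
have [p _ pE] := banach_fixed_point ctr closedT (ex_intro _ 0 I).
by exists p.
Qed.

Section Penalization.
Context {R : realType} {H : completeNormedModType R} (ip : {dot H for (@idfun R)}).
Hypothesis ip_norm : induces_norm ip.
Context (C : set H) (C_nonempty : C !=set0) (C_closed : closed C)
  (C_convex : convex_set C).
Context (f : H -> \bar R) (f_Gamma0 : Gamma0 f).
Implicit Types (x y z p q u v w : H).

(** Optimality conditions of the problem in which the base point [x'] is
    approached by [x] in [C], [f] is taken at a second point [y], and half the
    squared distance from [x] to [y] is added with weight [1 / l]; here [v] stands
    for [(x - y) / l]. *)
Definition penalized x' l x v :=
  normal_cone ip C x (x' - x - v) /\ subgradient ip f (x - l *: v) v.

Lemma normal_cone_scale p w c : 0 <= c -> normal_cone ip C p w ->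
  normal_cone ip C p (c *: w).
Proof.
move=> c0 [Cp hp]; split=> // y Cy; rewrite ipZl.
by rewrite mulr_ge0_le0// hp.
Qed.

Lemma proj_nonexpansive x y : `|proj C x - proj C y| <= `|x - y|.
Proof.
apply: (firm_nonexpansive ip_norm).
have := normal_cone_monotone (proj_normal_cone ip_norm x C_nonempty C_closed C_convex)
  (proj_normal_cone ip_norm y C_nonempty C_closed C_convex).
by rewrite -ip_norm; ip_expand ip; lra.
Qed.

(** Minimizing alternately over the two variables is a contraction of ratio [1 /
    (1 + l)], because the quadratic attached to [C] is strongly convex. *)
Lemma penalized_exists x' l : 0 < l -> exists x v, penalized x' l x v.
Proof.
move=> l0; have fl := Gamma0_scale l0 f_Gamma0.
have l1 : 0 < 1 + l by lra.
pose P y := proj C ((1 + l)^-1 *: (l *: x' + y)).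
pose T y := prox (fun y => (l%:E * f y)%E) (P y).
have [|y z|y yE] := @contraction_fixpoint _ _ T (1 + l)^-1.
- by rewrite invr_ge0 ltW//= invf_lt1//; lra.
- apply: (le_trans (prox_nonexpansive ip_norm _ _ fl)).
  apply: (le_trans (proj_nonexpansive _ _)).
  have -> : (1 + l)^-1 *: (l *: x' + y) - (1 + l)^-1 *: (l *: x' + z)
          = (1 + l)^-1 *: (y - z).
    by vec ip ip_norm.
  by rewrite normrZ ger0_norm// invr_ge0 ltW.
exists (P y), (l^-1 *: (P y - y)); split.
  have := proj_normal_cone ip_norm ((1 + l)^-1 *: (l *: x' + y))
    C_nonempty C_closed C_convex.
  (* This multiple turns the residual of the averaged point into the multiplier. *)
  move/(normal_cone_scale (_ : 0 <= (1 + l) / l)) => /(_ (divr_ge0 (ltW l1) (ltW l0))).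
  rewrite -/(P y); congr normal_cone.
  apply: (ip_vec_eq ip_norm); ip_expand ip; field; rewrite ?gt_eqF//.
have := subgradient_scale l0 (prox_subgradient ip_norm (P y) fl).
rewrite -/(T y) -yE; congr subgradient.
by rewrite scalerA mulfV ?gt_eqF// scale1r opprB addrC subrK.
Qed.

Lemma penalized_monotone x' l m x v y w :
  penalized x' l x v -> penalized x' m y w ->
  `|x - y| ^+ 2 + ip (v - w) (l *: v - m *: w) <= 0.
Proof.
move=> [nx sx] [ny sy].
have := normal_cone_monotone nx ny; have := subgradient_monotone sx sy.
by rewrite -ip_norm; ip_expand ip; lra.
Qed.

(** Maximal monotonicity by the device of Minty: the resolvent at [p + v] exists,
    and monotonicity against its value forces that value to be [p]. *)
Lemma subgradient_maximal p v :
  (forall y w, subgradient ip f y w -> 0 <= ip (w - v) (y - p)) ->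
  subgradient ip f p v.
Proof.
move=> h; have sq := prox_subgradient ip_norm (p + v) f_Gamma0.
set q := prox f (p + v) in sq *.
have pq : p = q.
  apply: (ip_vec_eq ip_norm); have := h _ _ sq => hq.
  apply/eqP; rewrite eq_le; apply/andP; split; last by rewrite ip_norm sqr_ge0.
  by move: hq; ip_expand ip; lra.
by move: sq; rewrite -pq addrC addKr.
Qed.

Lemma normal_cone_closed (p v : nat -> H) p0 v0 :
  p @ \oo --> p0 -> v @ \oo --> v0 ->
  (forall n, normal_cone ip C (p n) (v n)) -> normal_cone ip C p0 v0.
Proof.
move=> pp vv h; split.
  by apply: (closed_cvg C) pp => //; apply: nearW => n; exact: (h n).1.
move=> y Cy; apply: (cvgr_to_le (ip_cvg ip_norm vv (cvgB (cvg_cst y) pp))).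
by apply: nearW => n; exact: (h n).2.
Qed.

(** Monotonicity inequalities pass to the limit, and maximality turns the limit
    inequalities into membership in the graph. *)
Lemma subgradient_closed (p v : nat -> H) p0 v0 :
  p @ \oo --> p0 -> v @ \oo --> v0 ->
  (forall n, subgradient ip f (p n) (v n)) -> subgradient ip f p0 v0.
Proof.
move=> pp vv h; apply: subgradient_maximal => y w sy.
apply: (cvgr_to_ge (ip_cvg ip_norm (cvgB (cvg_cst w) vv) (cvgB (cvg_cst y) pp))).
by apply: nearW => n; exact: subgradient_monotone sy (h n).
Qed.

(** Letting the penalty parameter decrease to 0 makes the norms of the multipliers
    increase. If they stay bounded, the increments of the squared norms control
    the squared distances, so the multipliers converge strongly. *)
Lemma multiplier_of_bound x' K :
  (forall l x v, 0 < l <= 1 -> penalized x' l x v -> `|v| <= K) ->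
  exists p v, [/\ subgradient ip f p v, normal_cone ip C p (x' - p - v) & `|v| <= K].
Proof.
move=> hK; pose l n : R := n.+1%:R^-1.
have l0 n : 0 < l n <= 1 by rewrite invr_gt0 ltr0n invf_le1 ?ltr0n// ler1n.
have /choice[xv xvP] n : exists xv, penalized x' (l n) xv.1 xv.2.
  have /andP[ln0 _] := l0 n.
  by have [x [v h]] := penalized_exists x' ln0; exists (x, v).
pose x n := (xv n).1; pose v n := (xv n).2.
have vK n : `|v n| <= K by exact: hK (xvP n).
have K0 : 0 <= K by exact: le_trans (vK 0%N).
have ldec n k : (n < k)%N -> l k < l n.
  by move=> nk; rewrite ltf_pV2 ?posrE ?ltr0n// ltr_nat.
(* Dividing the monotonicity estimate by [l n + l k] shows that the norms
   increase and that their increments dominate the squared distances. *)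
have step n k : (n <= k)%N -> `|v n - v k| ^+ 2 <= `|v k| ^+ 2 - `|v n| ^+ 2.
  rewrite leq_eqVlt => /predU1P[->|]; first by rewrite !subrr normr0 expr0n.
  move=> /ldec lkn; have := penalized_monotone (xvP n) (xvP k).
  have /andP[ln0 _] := l0 n; have /andP[lk0 _] := l0 k.
  have := sqr_ge0 `|x n - x k|; rewrite -/(x n) -/(x k) -/(v n) -/(v k).
  set d := `|x n - x k| ^+ 2; have := sqr_ge0 `|v n - v k|.
  rewrite -!ip_norm; ip_expand ip.
  move: (ip (v n) (v n)) (ip (v k) (v k)) (ip (v n) (v k)) => a b c.
  move: (l n) (l k) lkn ln0 lk0 => s t st s0 t0 h1 h2 h3.
  have key : (s + t) * (a + b - 2 * c) <= (s - t) * (b - a) by lra.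
  have D0 : 0 <= a + b - 2 * c by lra.
  have st0 : 0 < s + t by lra.
  have ba : 0 <= b - a.
    rewrite -(pmulr_rge0 _ (_ : 0 < s - t)) ?subr_gt0//.
    by apply: le_trans key; rewrite mulr_ge0// ltW.
  have : (s + t) * (a + b - 2 * c) <= (s + t) * (b - a).
    by apply: (le_trans key); apply: ler_wpM2r => //; lra.
  by rewrite ler_pM2l//; lra.
have nd : nondecreasing_seq (fun n => `|v n| ^+ 2).
  move=> n k nk; have := step _ _ nk; have := sqr_ge0 `|v n - v k|; lra.
have ub : has_ubound (range (fun n => `|v n| ^+ 2)).
  by exists (K ^+ 2) => _ [n _ <-]; rewrite lerXn2r ?nnegrE.
have cvgN := nondecreasing_cvgn nd ub.
set N := sup _ in cvgN.
have leN n : `|v n| ^+ 2 <= N by apply: ub_le_sup => //; exists n.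
have cvgv : cvgn v.
  apply: (@cauchy_of_sqr_dist _ _ _ (fun n => N - `|v n| ^+ 2)).
    by rewrite -(subrr N); apply: cvgB => //; exact: cvg_cst.
  move=> n k; case/orP: (leq_total n k) => nk.
    by have := step _ _ nk; have := leN k; lra.
  by rewrite distrC; have := step _ _ nk; have := leN n; lra.
have cvgl : l @ \oo --> (0 : R) by exact: cvg_harmonic.
have cvgx : cvgn x.
  apply: (@cauchy_of_sqr_dist _ _ _ (fun n => 2 * K ^+ 2 * l n)).
    by rewrite -(mulr0 (2 * K ^+ 2)); apply: cvgM => //; exact: cvg_cst.
  move=> n k; have := penalized_monotone (xvP n) (xvP k).
  rewrite -/(x n) -/(x k) -/(v n) -/(v k) => h.
  have /andP[ln0 _] := l0 n; have /andP[lk0 _] := l0 k.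
  have h1 : - ip (v n - v k) (l n *: v n - l k *: v k) <= 2 * K * ((l n + l k) * K).
    rewrite -(ipNl ip); apply: (le_trans (ip_le_norm ip_norm _ _)).
    apply: ler_pM => //.
      by rewrite normrN (le_trans (ler_normB _ _))//; have := vK n; have := vK k; lra.
    rewrite (le_trans (ler_normB _ _))// !normrZ !gtr0_norm// mulrDl.
    by apply: lerD; apply: ler_wpM2l => //; exact: ltW.
  by move: h h1; move: (l n) (l k) => a b; lra.
exists (limn x), (limn v); split.
- apply: (@subgradient_closed (fun n => x n - l n *: v n) v) => //.
    rewrite -[X in _ --> X]subr0; apply: cvgB => //.
    by rewrite -(scale0r (limn v)); exact: cvgZ.
  by move=> n; exact: (xvP n).2.
- apply: (@normal_cone_closed x (fun n => x' - x n - v n)) => //.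
    by apply: cvgB => //; apply: cvgB => //; exact: cvg_cst.
  by move=> n; exact: (xvP n).1.
- by apply: (cvgr_to_le (cvg_norm cvgv)); exact: nearW.
Qed.

End Penalization.

(** * Constraint qualifications *)

Section Regularity.
Context {R : realType} {H : completeNormedModType R} (ip : {dot H for (@idfun R)}).
Hypothesis ip_norm : induces_norm ip.
Implicit Types (x y z p q u v w : H) (C D V : set H).

(** What a constraint qualification has to provide: a family of vectors is bounded
    as soon as it is bounded above against each difference of a point of [D] and a
    point of [C]. Only multiples of such differences are considered, since in
    finite dimension nothing is known outside the subspace they span. *)
Definition regular_pair C D := forall V : set H,
  (forall v, V v -> exists t x y, [/\ C x, D y & v = t *: (x - y)]) ->
  (forall x y, C x -> D y -> exists K, forall v, V v -> ip v (y - x) <= K) ->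
  exists K, forall v, V v -> `|v| <= K.

(** One-sided bounds are enough, since they are available for both [d] and [- d]. *)
Lemma uniform_boundedness V :
  (forall d, exists K, forall v, V v -> ip v d <= K) ->
  exists K, forall v, V v -> `|v| <= K.
Proof.
move=> h.
have [|d|K hK] := @Banach_Steinhauss R H R^o
  [set (fun x => ip v x : R^o) | v in V] _ _ 1.
- move=> _ [v Vv <-]; split.
    move=> r; exists (`|v| * `|r|) => x xr.
    apply: (le_trans (norm_ip_le ip_norm _ _)); apply: ler_wpM2l => //.
    by apply: (le_trans xr); exact: ler_norm.
  by move=> a x y; rewrite ipDr ipZr.
- have [K1 h1] := h d; have [K2 h2] := h (- d).
  exists (Num.max K1 K2) => _ [v Vv <-].
  have a1 := h1 v Vv; have a2 := h2 v Vv; rewrite ipNr in a2.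
  by rewrite ler_norml lerNl !le_max a1 a2 orbT.
exists K => v Vv.
have [->|v0] := eqVneq v 0.
  rewrite normr0; have := hK _ (ex_intro2 _ _ v Vv erefl) 0.
  by rewrite normr0 ler01 => /(_ isT); apply: le_trans.
have nv : 0 < `|v| by rewrite normr_gt0.
have := hK _ (ex_intro2 _ _ v Vv erefl) (`|v|^-1 *: v).
rewrite normrZ gtr0_norm ?invr_gt0// mulVf ?gt_eqF// lexx => /(_ isT).
rewrite ipZr ip_norm expr2 mulKf ?gt_eqF// => /(le_trans _); apply.
exact: ler_norm.
Qed.

Lemma interior_direction C c d : C° c -> exists2 r, 0 < r & C (c + r *: d).
Proof.
move=> /nbhs_ballP[e /= e0 eC]; exists (e / (2 * (`|d| + 1))).
  by rewrite divr_gt0// mulr_gt0// ltr_wpDl.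
apply: eC; rewrite -ball_normE/= opprD addrA subrr sub0r normrN normrZ.
have d1 : 0 < `|d| + 1 by rewrite ltr_wpDl.
rewrite ger0_norm ?divr_ge0 ?mulr_ge0 ?(ltW e0) ?(ltW d1)//.
rewrite mulrAC ltr_pdivrMr ?mulr_gt0//.
have := normr_ge0 d; nra.
Qed.

Lemma regular_interior_right C D : C `&` D° !=set0 -> regular_pair C D.
Proof.
move=> [c [Cc Dc]] V _ VB; apply: uniform_boundedness => d.
have [r r0 Dr] := interior_direction d Dc.
have [K hK] := VB _ _ Cc Dr; exists (K / r) => v /hK.
by rewrite addrAC subrr add0r ipZr ler_pdivlMr// mulrC.
Qed.

Lemma regular_interior_left C D : D `&` C° !=set0 -> regular_pair C D.
Proof.
move=> [c [Dc Cc]] V _ VB; apply: uniform_boundedness => d.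
have [r r0 Cr] := interior_direction (- d) Cc.
have [K hK] := VB _ _ Cr Dc; exists (K / r) => v /hK.
by rewrite opprD addrA subrr sub0r scalerN opprK ipZr ler_pdivlMr// mulrC.
Qed.

Definition orthonormal_family m (u : 'I_m -> H) :=
  forall i j, ip (u i) (u j) = (i == j)%:R.

Lemma ip_suml I (r : seq I) (P : pred I) (F : I -> H) w :
  ip (\sum_(i <- r | P i) F i) w = \sum_(i <- r | P i) ip (F i) w.
Proof. by apply: (big_morph (fun v => ip v w)) => [x y|]; rewrite ?ipDl ?ip0l. Qed.

Lemma ip_sumr I (r : seq I) (P : pred I) (F : I -> H) w :
  ip w (\sum_(i <- r | P i) F i) = \sum_(i <- r | P i) ip w (F i).
Proof. by apply: (big_morph (ip w)) => [x y|]; rewrite ?ipDr ?ip0r. Qed.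

(** Expressing the family in [e] factors the identity matrix of size [m] through a
    space of dimension [n]. *)
Lemma orthonormal_size n (e : 'I_n -> H) m (u : 'I_m -> H) :
  (forall x, exists a : 'I_n -> R, x = \sum_(i < n) a i *: e i) ->
  orthonormal_family u -> (m <= n)%N.
Proof.
move=> espan uo; have /choice[a aE] i := espan (u i).
pose A := \matrix_(i < m, j < n) a i j.
pose G := \matrix_(i < n, j < n) ip (e i) (e j).
have : A *m G *m A^T = 1%:M.
  apply/matrixP => i j; rewrite !mxE -uo.
  rewrite [X in _ = ip _ X](aE j).
  rewrite ip_sumr.
  apply: eq_bigr => k _; rewrite ipZr !mxE mulrC; congr (_ * _).
  rewrite [X in _ = ip X _](aE i) ip_suml; apply: eq_bigr => l _.
  by rewrite ipZl !mxE.
move=> /(congr1 mxrank); rewrite mxrank1 => <-.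
rewrite -mulmxA; apply: (leq_trans (mxrankM_maxl _ _)); exact: rank_leq_col.
Qed.

(** An orthonormal family of maximal size in [L] spans [L]: the component of a
    vector orthogonal to the family could otherwise be normalized and added to it. *)
Lemma orthonormal_basis (L : set H) : finite_dimensional H ->
  (forall x y, L x -> L y -> L (x + y)) -> (forall a x, L x -> L (a *: x)) ->
  exists m (u : 'I_m -> H), (forall i, L (u i)) /\
    forall v, L v -> v = \sum_(i < m) ip v (u i) *: u i.
Proof.
move=> [n [e espan]] LD LZ.
pose P m := `[< exists u : 'I_m -> H, (forall i, L (u i)) /\ orthonormal_family u >].
have P0 : exists m, P m.
  by exists 0%N; apply/asboolP; exists (fun=> 0); split=> [[]//|[]//].
have Pn m : P m -> (m <= n)%N.
  by move=> /asboolP[u [_ uo]]; exact: orthonormal_size espan uo.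
have [m /asboolP[u [Lu uo]] mmax] := ex_maxnP P0 Pn.
exists m, u; split=> // v Lv.
have Lsum : forall w, L w -> L (w + - \sum_(i < m) ip v (u i) *: u i).
  move=> w Lw; elim/big_rec : _ => [|i s _ Ls]; first by rewrite subr0.
  have -> : w - (ip v (u i) *: u i + s) = (w - s) + (- ip v (u i)) *: u i by vec ip ip_norm.
  by apply: LD => //; exact: LZ.
apply/eqP; rewrite -subr_eq0; apply/eqP.
set w := v - _; have Lw : L w by exact: Lsum.
have [//|w0] := eqVneq w 0; exfalso.
have wu j : ip w (u j) = 0.
  rewrite /w ipDl ipNl ip_suml (bigD1 j)//= big1 => [|i ij].
    by rewrite ipZl uo eqxx mulr1 addr0 subrr.
  by rewrite ipZl uo (negbTE ij) mulr0.
have nw : 0 < `|w| by rewrite normr_gt0.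
pose u' (i : 'I_m.+1) := if unlift ord_max i is Some j then u j else `|w|^-1 *: w.
suff : P m.+1 by move/mmax; rewrite ltnn.
apply/asboolP; exists u'; split=> [i|i j]; rewrite /u'.
  by case: unliftP => [k _|_]; [exact: Lu|exact: LZ].
case: unliftP => [k ->|->]; case: unliftP => [l ->|->].
- by rewrite uo (inj_eq lift_inj).
- by rewrite ipZr ipC wu mulr0 eq_sym (negbTE (neq_lift _ _)).
- by rewrite ipZl wu mulr0 (negbTE (neq_lift _ _)).
- by rewrite ipZl ipZr ip_norm eqxx expr2 mulKf ?gt_eqF// mulVf ?gt_eqF.
Qed.

Lemma affine_hull_sub C x : C x -> affine_hull C x.
Proof.
move=> Cx; exists 1%N, (fun=> 1), (fun=> x); split=> //; rewrite big_ord1//.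
by rewrite scale1r.
Qed.

Lemma affine_hull_combination C x y a b :
  affine_hull C x -> affine_hull C y -> a + b = 1 ->
  affine_hull C (a *: x + b *: y).
Proof.
move=> [n [s [c [Cc s1 ->]]]] [m [t [d [Cd t1 ->]]]] ab.
exists (n + m)%N,
  (fun i : 'I_(n + m) =>
     match fintype.split i with inl j => a * s j | inr j => b * t j end),
  (fun i : 'I_(n + m) =>
     match fintype.split i with inl j => c j | inr j => d j end); split.
- by move=> i; case: fintype.split.
- rewrite big_split_ord/=.
  have <- : a * (\sum_(i < n) s i) + b * (\sum_(i < m) t i) = 1 by rewrite s1 t1 !mulr1.
  rewrite !mulr_sumr.
  by congr (_ + _); apply: eq_bigr => i _;
    [rewrite (unsplitK (inl i))|rewrite (unsplitK (inr i))].
- rewrite big_split_ord/= !scaler_sumr.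
  by congr (_ + _); apply: eq_bigr => i _; rewrite scalerA;
    [rewrite (unsplitK (inl i))|rewrite (unsplitK (inr i))].
Qed.

(** A direction of the affine hull can be followed for a short while inside the
    set itself. *)
Lemma rint_direction C c a : rint C c -> affine_hull C (c + a) ->
  exists2 r0, 0 < r0 & forall r, 0 < r <= r0 -> C (c + r *: a).
Proof.
move=> [Cc /nbhs_ballP[e /= e0 eC]] ha; exists (e / (2 * (`|a| + 1))).
  by rewrite divr_gt0// mulr_gt0// ltr_wpDl.
move=> r /andP[r0 re]; apply: eC.
  rewrite -ball_normE/= opprD addrA subrr sub0r normrN normrZ.
  have d1 : 0 < `|a| + 1 by rewrite ltr_wpDl.
  move: re; rewrite ler_pdivlMr ?mulr_gt0// gtr0_norm//.
  have := normr_ge0 a; nra.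
have -> : c + r *: a = (1 - r) *: c + r *: (c + a) by vec ip ip_norm.
by apply: affine_hull_combination => //; [exact: affine_hull_sub|rewrite subrK].
Qed.

(** The vectors of [V] lie in the sum [L] of the directions of the two affine
    hulls. A vector of [L] splits into a direction of each hull, along which both
    relative interiors leave room, so [V] is bounded against each vector of an
    orthonormal basis of [L]. *)
Lemma regular_rint C D : finite_dimensional H -> rint C `&` rint D !=set0 ->
  regular_pair C D.
Proof.
move=> Hfin [c [rC rD]] V VL VB.
pose L := [set d | exists a b,
  [/\ affine_hull C (c + a), affine_hull D (c + b) & d = b - a]].
have affD (S : set H) a b : S c -> affine_hull S (c + a) -> affine_hull S (c + b) ->
    affine_hull S (c + (a + b)).
  move=> Sc ha hb.
  have -> : c + (a + b) = 2 *: (2^-1 *: (c + a) + 2^-1 *: (c + b)) + (- 1) *: c.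
    by vec ip ip_norm.
  apply: affine_hull_combination; [|exact: affine_hull_sub|lra].
  by apply: affine_hull_combination => //; lra.
have affZ (S : set H) a t : S c -> affine_hull S (c + a) -> affine_hull S (c + t *: a).
  move=> Sc ha; have -> : c + t *: a = t *: (c + a) + (1 - t) *: c by vec ip ip_norm.
  by apply: affine_hull_combination => //; [exact: affine_hull_sub|lra].
have [Cc Dc] : C c /\ D c by split; [exact: rC.1|exact: rD.1].
have [||m [u [Lu uE]]] := @orthonormal_basis L Hfin.
  move=> _ _ [a [b [ha hb ->]]] [a' [b' [ha' hb' ->]]].
  by exists (a + a'), (b + b'); split; [exact: affD|exact: affD|vec ip ip_norm].
  move=> t _ [a [b [ha hb ->]]].
  by exists (t *: a), (t *: b); split; [exact: affZ|exact: affZ|rewrite scalerBr].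
have pt d : L d -> exists K, forall v, V v -> ip v d <= K.
  move=> [a [b [ha hb ->]]].
  have [r1 r10 hr1] := rint_direction rC ha.
  have [r2 r20 hr2] := rint_direction rD hb.
  pose r := Num.min r1 r2; have r0 : 0 < r by rewrite lt_min r10.
  have [K hK] : exists K, forall v, V v -> ip v (c + r *: b - (c + r *: a)) <= K.
    by apply: VB; [apply: hr1|apply: hr2]; rewrite r0 ge_min lexx ?orbT.
  exists (K / r) => v /hK; rewrite ler_pdivlMr//; ip_expand ip; lra.
have /choice[B BP] i : exists K, forall v, V v -> `|ip v (u i)| <= K.
  have LN : L (- u i).
    have [a [b [ha hb ->]]] := Lu i; exists (- a), (- b).
    by rewrite -!(scaleN1r a) -!(scaleN1r b); split; [exact: affZ|exact: affZ|vec ip ip_norm].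
  have [K1 h1] := pt _ (Lu i); have [K2 h2] := pt _ LN.
  exists (Num.max K1 K2) => v Vv.
  have a1 := h1 v Vv; have a2 := h2 v Vv; rewrite ipNr in a2.
  by rewrite ler_norml lerNl !le_max a1 a2 orbT.
exists (\sum_(i < m) B i * `|u i|) => v Vv.
have Lv : L v.
  have [t [x [y [Cx Dy ->]]]] := VL v Vv; exists ((- t) *: (x - c)), ((- t) *: (y - c)).
  split; [apply: affZ => //|apply: affZ => //|vec ip ip_norm].
    by rewrite addrC subrK; exact: affine_hull_sub.
  by rewrite addrC subrK; exact: affine_hull_sub.
rewrite {1}(uE _ Lv); apply: (le_trans (ler_norm_sum _ _ _)).
by apply: ler_sum => i _; rewrite normrZ; apply: ler_wpM2r => //; exact: BP.
Qed.

Lemma qualification_regular C D :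
  [\/ C `&` D° !=set0, D `&` C° !=set0
    | finite_dimensional H /\ rint C `&` rint D !=set0] -> regular_pair C D.
Proof.
by case=> [|| [Hfin]]; [exact: regular_interior_right|exact: regular_interior_left
  |exact: regular_rint].
Qed.

End Regularity.

(** * Uniformly bounded multipliers *)

Section Multipliers.
Context {R : realType} {H : completeNormedModType R} (ip : {dot H for (@idfun R)}).
Hypothesis ip_norm : induces_norm ip.
Context (C : set H) (C_nonempty : C !=set0) (C_closed : closed C)
  (C_convex : convex_set C).
Context (f : H -> \bar R) (f_Gamma0 : Gamma0 f).
Hypothesis Cf_regular : regular_pair ip C (dom f).

(** The two optimality conditions, tested at [c] in [C] and [d] in [dom f], bound
    the multipliers from above against [d - c] independently of the penalty
    parameter and of the base point. *)
Lemma penalized_bounded rho : exists K, forall x' l x v,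
  `|x'| <= rho -> 0 < l <= 1 -> penalized ip C f x' l x v -> `|v| <= K.
Proof.
pose V := [set v | exists x' l x, [/\ `|x'| <= rho, 0 < l <= 1 & penalized ip C f x' l x v]].
suff [K hK] : exists K, forall v, V v -> `|v| <= K.
  by exists K => x' l x v hx hl hp; apply: hK; exists x', l, x.
apply: Cf_regular.
  move=> v [x' [l [x [_ /andP[l0 _] [nx sx]]]]].
  exists l^-1, x, (x - l *: v); split; first exact: nx.1.
    by rewrite /dom/= ltey_eq sx.1.
  by rewrite opprB addrC subrK scalerA mulVf ?gt_eqF// scale1r.
move=> c d Cc Dd; have fd := Gamma0_fin f_Gamma0 Dd.
have [y0 [a [b [b0 hmin]]]] := Gamma0_minorant ip_norm f_Gamma0.
pose k := rho + `|c|.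
exists (fine (f d) - a + b ^+ 2 / 4 + b * `|c - y0| + (k + b) ^+ 2 / 4).
move=> v [x' [l [x [hx /andP[l0 l1] [nx sx]]]]].
set y := x - l *: v in sx *.
have fy : a - b * `|y - y0| <= fine (f y) by rewrite -lee_fin fineK// sx.1.
have h1 := subgradient_fine sx fd.
have h2 := nx.2 c Cc.
have yy : `|y - y0| <= l * `|v| + `|x - c| + `|c - y0|.
  rewrite -[l]gtr0_norm// -normrZ.
  have -> : y - y0 = - (l *: v) + (x - c) + (c - y0) by vec ip ip_norm.
  by rewrite (le_trans (ler_normD _ _))// lerD2r (le_trans (ler_normD _ _))// normrN.
have h3 := ler_wpM2l b0 yy.
have h4 : ip (x' - c) (x - c) <= k * `|x - c|.
  apply: (le_trans (ip_le_norm ip_norm _ _)); apply: ler_wpM2r => //.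
  by rewrite (le_trans (ler_normB _ _))// lerD2r.
(* The penalty term absorbs the linear growth of the minorant along [l *: v]. *)
have h5 : b * (l * `|v|) <= l * `|v| ^+ 2 + b ^+ 2 / 4.
  have := sqr_ge0 (`|v| - b / 2); have := sqr_ge0 b; nra.
have h6 := sqr_ge0 (`|x - c| - (k + b) / 2).
have -> : ip v (d - c) = ip v (d - y) - l * `|v| ^+ 2 + ip v (x - c).
  by rewrite /y -ip_norm; ip_expand ip; ring.
have h7 : ip v (x - c) <= ip (x' - c) (x - c) - `|x - c| ^+ 2.
  by move: h2; rewrite -ip_norm; ip_expand ip; lra.
lra.
Qed.

(** This is the subdifferential sum rule for [f] and the quadratic constrained to
    [C], with a bound on the multiplier that is uniform over balls of base points. *)
Lemma multiplier_exists rho : exists K, forall x', `|x'| <= rho ->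
  exists p v, [/\ subgradient ip f p v, normal_cone ip C p (x' - p - v) & `|v| <= K].
Proof.
have [K hK] := penalized_bounded rho; exists K => x' hx.
by apply: (multiplier_of_bound ip_norm C_nonempty C_closed C_convex f_Gamma0) => l x v;
  exact: hK.
Qed.

End Multipliers.

(** * The Douglas-Rachford operator and its envelope *)

Section DouglasRachford.
Context {R : realType} {H : completeNormedModType R} (ip : {dot H for (@idfun R)}).
Hypothesis ip_norm : induces_norm ip.
Context (C : set H) (C_nonempty : C !=set0) (C_closed : closed C)
  (C_convex : convex_set C).
Context (f : H -> \bar R) (f_Gamma0 : Gamma0 f).
Implicit Types (x y z p q u v w : H).

(** The proximal point at [z] of the quadratic centred at [x'] constrained to [C]. *)
Definition shadow x' z := proj C (2^-1 *: (z + x')).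
Definition prox_shadow x' z := prox f (2 *: shadow x' z - z).
(** The composition of the reflections through the two proximal points, that is, a
    Douglas-Rachford step with parameter 2. *)
Definition reflect x' z := z + 2 *: (prox_shadow x' z - shadow x' z).

Lemma shadow_normal x' z :
  normal_cone ip C (shadow x' z) (z + x' - 2 *: shadow x' z).
Proof.
have := proj_normal_cone ip_norm (2^-1 *: (z + x')) C_nonempty C_closed C_convex.
move/(normal_cone_scale (ler0n R 2)); rewrite -/(shadow x' z).
by congr normal_cone; vec ip ip_norm.
Qed.

Lemma prox_shadow_subgradient x' z : subgradient ip f (prox_shadow x' z)
  (2 *: shadow x' z - z - prox_shadow x' z).
Proof. exact: prox_subgradient. Qed.

(** The factor 2 is the strong convexity of the quadratic attached to [C]. *)
Lemma shadow_cocoercive x' z w :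
  2 * `|shadow x' z - shadow x' w| ^+ 2 <= ip (z - w) (shadow x' z - shadow x' w).
Proof.
have := normal_cone_monotone (shadow_normal x' z) (shadow_normal x' w).
by rewrite -ip_norm; ip_expand ip; lra.
Qed.

Lemma shadow_nonexpansive x' z w : `|shadow x' z - shadow x' w| <= `|z - w|.
Proof.
apply: (firm_nonexpansive ip_norm); have := shadow_cocoercive x' z w.
by have := sqr_ge0 `|shadow x' z - shadow x' w|; lra.
Qed.

(** The reflection through [prox f] is nonexpansive; the one through the shadow
    loses four times the squared displacement of the shadow, by its stronger
    cocoercivity. *)
Lemma reflect_contract x' z w :
  `|reflect x' z - reflect x' w| ^+ 2 + 4 * `|shadow x' z - shadow x' w| ^+ 2 <= `|z - w| ^+ 2.
Proof.
have h1 := shadow_cocoercive x' z w.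
have := subgradient_monotone (prox_shadow_subgradient x' z) (prox_shadow_subgradient x' w).
move: h1; rewrite /reflect -!ip_norm; ip_expand ip; lra.
Qed.

Lemma reflect_nonexpansive x' z w : `|reflect x' z - reflect x' w| <= `|z - w|.
Proof.
rewrite -(@ler_pXn2r _ 2) ?nnegrE//; have := reflect_contract x' z w.
have := sqr_ge0 `|shadow x' z - shadow x' w|; lra.
Qed.

(** The Douglas-Rachford envelope, or the Lagrangian dual function read off at the
    current pair of proximal points. *)
Definition envelope x' z :=
  fine (f (prox_shadow x' z)) + 2^-1 * `|shadow x' z - x'| ^+ 2
  + ip (prox_shadow x' z - shadow x' z) (z - shadow x' z)
  + 2^-1 * `|prox_shadow x' z - shadow x' z| ^+ 2.

(** Adding the subgradient inequality of [f] between consecutive proximal points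
    and the variational inequality of the shadow gives exactly this square as the
    surplus. *)
Lemma envelope_increase x' z :
  envelope x' z + 2^-1 * `|prox_shadow x' z + prox_shadow x' (reflect x' z)
                           - 2 *: shadow x' (reflect x' z)| ^+ 2
    <= envelope x' (reflect x' z).
Proof.
rewrite /envelope.
have h1 := subgradient_fine (prox_shadow_subgradient x' z)
  (prox_shadow_subgradient x' (reflect x' z)).1.
have h2 := (shadow_normal x' z).2 _ (shadow_normal x' (reflect x' z)).1.
have [zp zpE] : exists zp, zp = reflect x' z by exists (reflect x' z).
rewrite -zpE in h1 h2 *; move: h1 h2 zpE; rewrite /reflect.
move: (fine (f (prox_shadow x' z))) (fine (f (prox_shadow x' zp))) => fc fc'.
move: (shadow x' z) (shadow x' zp) (prox_shadow x' z) (prox_shadow x' zp).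
move=> b b' c c' + + ->.
rewrite -!ip_norm; ip_expand ip; lra.
Qed.

Section FixedPoint.
Variables (x' p v : H).
Hypothesis (pv : subgradient ip f p v) (pn : normal_cone ip C p (x' - p - v)).
Let zs := p - v.

(** The multiplier [v] places a fixed point of the reflection at [p - v], whose
    shadow is the constrained proximal point [p]. *)
Lemma shadow_multiplier : shadow x' zs = p.
Proof.
have := normal_cone_monotone (shadow_normal x' zs) pn; rewrite /zs => h.
apply: (ip_vec_eq ip_norm); apply/eqP; rewrite eq_le; apply/andP; split.
  by move: h; ip_expand ip; lra.
by rewrite ip_norm sqr_ge0.
Qed.

Lemma prox_shadow_multiplier : prox_shadow x' zs = p.
Proof.
apply: (subgradient_unique ip_norm (prox_shadow_subgradient x' zs)).
by rewrite shadow_multiplier; congr subgradient: pv; rewrite /zs; vec ip ip_norm.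
Qed.

Lemma reflect_multiplier : reflect x' zs = zs.
Proof.
by rewrite /reflect prox_shadow_multiplier shadow_multiplier subrr scaler0 addr0.
Qed.

(** The contraction estimate at the fixed point is what makes the squared errors
    of the shadow summable along an orbit. *)
Lemma reflect_fejer z :
  `|reflect x' z - zs| ^+ 2 + 4 * `|shadow x' z - p| ^+ 2 <= `|z - zs| ^+ 2.
Proof.
by have := reflect_contract x' z zs; rewrite reflect_multiplier shadow_multiplier.
Qed.

Lemma reflect_dist z : `|reflect x' z - zs| <= `|z - zs|.
Proof. by have := reflect_nonexpansive x' z zs; rewrite reflect_multiplier. Qed.

(** Weak duality for the constrained proximal problem. *)
Lemma envelope_le z : envelope x' z <= fine (f p) + 2^-1 * `|p - x'| ^+ 2.
Proof.
have := subgradient_fine (prox_shadow_subgradient x' z) pv.1.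
have := (shadow_normal x' z).2 _ pn.1; rewrite /envelope.
have := sqr_ge0 `|prox_shadow x' z - p|.
move: (fine (f (prox_shadow x' z))) (fine (f p)) => fc fc'.
move: (shadow x' z) (prox_shadow x' z) => b c.
rewrite -!ip_norm; ip_expand ip; lra.
Qed.

(** Testing the multiplier at the proximal points makes the duality gap quadratic
    in the distance to the fixed point, and this bounds the total increase of the
    envelope along an orbit. *)
Lemma envelope_ge z : fine (f p) + 2^-1 * `|p - x'| ^+ 2 - `|z - zs| ^+ 2 <= envelope x' z.
Proof.
have := subgradient_fine pv (prox_shadow_subgradient x' z).1.
have := pn.2 _ (shadow_normal x' z).1; rewrite /envelope.
have h1 := reflect_contract x' z zs; have h2 := shadow_cocoercive x' z zs.
rewrite reflect_multiplier shadow_multiplier in h1 h2.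
have : - ip (prox_shadow x' z - shadow x' z) (z - zs - (shadow x' z - p)) <= `|z - zs| ^+ 2.
  rewrite -ipNl.
  have a1 : `|prox_shadow x' z - shadow x' z| <= `|z - zs|.
    have := ler_normB (reflect x' z - zs) (z - zs).
    have -> : reflect x' z - zs - (z - zs) = 2 *: (prox_shadow x' z - shadow x' z).
      by rewrite /reflect; vec ip ip_norm.
    rewrite normrZ ger0_norm//; have := reflect_dist z; lra.
  have a2 : `|z - zs - (shadow x' z - p)| <= `|z - zs|.
    rewrite -(@ler_pXn2r _ 2) ?nnegrE//; move: h2; have := sqr_ge0 `|shadow x' z - p|.
    by rewrite -!ip_norm; ip_expand ip; lra.
  apply: (le_trans (ip_le_norm ip_norm _ _)); rewrite normrN expr2.
  exact: ler_pM.
have := sqr_ge0 `|prox_shadow x' z - shadow x' z|.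
have := sqr_ge0 `|shadow x' z - p|.
rewrite /zs; move: (fine (f (prox_shadow x' z))) (fine (f p)) => fc fc'.
move: (shadow x' z) (prox_shadow x' z) => b c.
rewrite -!ip_norm; ip_expand ip; lra.
Qed.

End FixedPoint.
End DouglasRachford.

(** * Uniform convergence of the inner loop *)

(** The difference of the two squares factors into a difference at most [w] and a
    sum at most [2 * d]. *)
Lemma half_gap_le {R : realType} (a c w d s : R) : c ^+ 2 + 4 * s <= a ^+ 2 ->
  a <= w + c -> a <= d -> c <= d -> 0 <= a -> 0 <= c -> 0 <= w -> 2 * s <= d * w.
Proof.
move=> h awc ad cd a0 c0 w0.
have p1 : 0 <= (w + c - a) * (a + c) by apply: mulr_ge0; lra.
have p2 : 0 <= w * (2 * d - (a + c)) by apply: mulr_ge0; lra.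
lra.
Qed.

Section InnerLoop.
Context {R : realType} {H : completeNormedModType R} (ip : {dot H for (@idfun R)}).
Hypothesis ip_norm : induces_norm ip.
Context (C : set H) (C_nonempty : C !=set0) (C_closed : closed C)
  (C_convex : convex_set C).
Context (f : H -> \bar R) (f_Gamma0 : Gamma0 f).
Implicit Types (x y z p q u v w : H).

Local Notation S := (shadow C).
Local Notation Refl := (reflect C f).

Definition multiplier_pair x' p v := subgradient ip f p v /\ normal_cone ip C p (x' - p - v).

Section ReflectionOrbit.
Variables (x' p v : H) (pv : multiplier_pair x' p v).
Let zs := p - v.
Variable (z0 : H) (d : R) (d_ge : `|z0 - zs| <= d).
Let z m := iter m (Refl x') z0.

Let d0 : 0 <= d. Proof. exact: le_trans d_ge. Qed.

Lemma orbit_dist m : `|z m - zs| <= d.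
Proof.
elim: m => [//|m ih]; apply: le_trans ih; rewrite /z iterS.
exact: reflect_dist pv.1 pv.2 _.
Qed.

Let sqr_dist m : `|z m - zs| ^+ 2 <= d ^+ 2.
Proof. by rewrite lerXn2r ?nnegrE// orbit_dist. Qed.

(** The shadow converges, so a two-step displacement is governed by the square
    whose sum the envelope bounds. *)
Let diff_step m : z m.+2 - z m =
  2 *: (prox_shadow C f x' (z m) + prox_shadow C f x' (z m.+1) - 2 *: S x' (z m.+1))
  + 2 *: (S x' (z m.+1) - S x' (z m)).
Proof.
have -> : z m.+2 = z m.+1 + 2 *: (prox_shadow C f x' (z m.+1) - S x' (z m.+1)) by [].
have : z m.+1 = z m + 2 *: (prox_shadow C f x' (z m) - S x' (z m)) by [].
move: (prox_shadow C f x' (z m.+1)) (S x' (z m.+1)).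
move: (prox_shadow C f x' (z m)) (S x' (z m)).
move: (z m.+1) (z m) => a b s' t' s t ->; vec ip ip_norm.
Qed.

Let diff_noninc m k : (m <= k)%N -> `|z k.+2 - z k| <= `|z m.+2 - z m|.
Proof.
elim: k => [|k ih]; first by rewrite leqn0 => /eqP->.
rewrite leq_eqVlt => /predU1P[->//|]; rewrite ltnS => /ih; apply: le_trans.
exact: reflect_nonexpansive.
Qed.

(** Both the envelope and the squared distance to the fixed point telescope. *)
Let diff_sum m :
  \sum_(i < m) `|z i.+2 - z i| ^+ 2 + 4 * `|z m - zs| ^+ 2 + 4 * `|z m.+1 - zs| ^+ 2
    <= 16 * (envelope ip C f x' (z m) - envelope ip C f x' (z 0)) + 8 * d ^+ 2.
Proof.
elim: m => [|m ih].
  rewrite big_ord0 subrr; have := sqr_dist 0; have := sqr_dist 1; lra.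
rewrite big_ord_recr/=.
have e := envelope_increase ip_norm C_nonempty C_closed C_convex f_Gamma0 x' (z m).
have f1 := reflect_fejer ip_norm C_nonempty C_closed C_convex f_Gamma0 pv.1 pv.2 (z m).
have f2 := reflect_fejer ip_norm C_nonempty C_closed C_convex f_Gamma0 pv.1 pv.2 (z m.+1).
rewrite -/(z m.+1) -/(z m.+2) -/zs in e f1 f2.
have : `|z m.+2 - z m| ^+ 2
  <= 8 * `|prox_shadow C f x' (z m) + prox_shadow C f x' (z m.+1)
           - 2 *: S x' (z m.+1)| ^+ 2
     + 16 * `|S x' (z m.+1) - p| ^+ 2 + 16 * `|S x' (z m) - p| ^+ 2.
  rewrite diff_step.
  move: (S x' (z m.+1)) (S x' (z m)) (prox_shadow C f x' (z m) + _ - _) => b' b t.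
  have := sqr_ge0 `|2 *: t - 2 *: (b' - b)|; have := sqr_ge0 `|(b' - p) + (b - p)|.
  by rewrite -!ip_norm; ip_expand ip; lra.
move: ih; rewrite -/(z m.+1) -/(z m.+2); lra.
Qed.

(** The squared two-step displacements are summable with a bound proportional to
    [d ^+ 2], and they are nonincreasing, so the last one is at most the average. *)
Lemma diff_rate m : m.+1%:R * `|z m.+2 - z m| ^+ 2 <= 24 * d ^+ 2.
Proof.
have h1 := envelope_le ip_norm C_nonempty C_closed C_convex f_Gamma0 pv.1 pv.2 (z m.+1).
have h2 := envelope_ge ip_norm C_nonempty C_closed C_convex f_Gamma0 pv.1 pv.2 (z 0).
have := diff_sum m.+1; rewrite -/zs in h2 *; have := sqr_dist 0.
have := sqr_ge0 `|z m.+1 - zs|; have := sqr_ge0 `|z m.+2 - zs|.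
have : m.+1%:R * `|z m.+2 - z m| ^+ 2 <= \sum_(i < m.+1) `|z i.+2 - z i| ^+ 2.
  rewrite mulr_natl -[X in _ *+ X]card_ord -sumr_const; apply: ler_sum => i _.
  by rewrite lerXn2r ?nnegrE// diff_noninc// -ltnS.
lra.
Qed.

(** Over two steps the squared distance to the fixed point can decrease by at most
    [2 * d] times the two-step displacement, and it decreases by at least four
    times the squared error of the shadow. *)
Lemma shadow_rate m : m.+1%:R * `|S x' (z m) - p| ^+ 4 <= 6 * d ^+ 4.
Proof.
have f1 := reflect_fejer ip_norm C_nonempty C_closed C_convex f_Gamma0 pv.1 pv.2 (z m).
rewrite -/(z m.+1) -/zs in f1.
have f2 : `|z m.+2 - zs| <= `|z m.+1 - zs|.
  exact: reflect_dist pv.1 pv.2 _.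
have a0 : 2 * `|S x' (z m) - p| ^+ 2 <= d * `|z m.+2 - z m|.
  apply: (@half_gap_le _ `|z m - zs| `|z m.+2 - zs|); rewrite ?orbit_dist//.
    by apply: le_trans f1; rewrite lerD2r lerXn2r ?nnegrE.
  by rewrite (distrC (z m.+2)) ler_distD.
have a1 : 4 * `|S x' (z m) - p| ^+ 4 <= d ^+ 2 * `|z m.+2 - z m| ^+ 2.
  have : (2 * `|S x' (z m) - p| ^+ 2) ^+ 2 <= (d * `|z m.+2 - z m|) ^+ 2.
    by rewrite lerXn2r ?nnegrE ?mulr_ge0.
  lra.
have := diff_rate m; have m0 : 0 <= (m.+1%:R : R) by [].
have := ler_wpM2l m0 a1 => h1 /(ler_wpM2l (sqr_ge0 d)) h2.
have -> : d ^+ 4 = d ^+ 2 * d ^+ 2 by rewrite -exprD.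
move: h1 h2; move: (m.+1%:R) (`|_| ^+ 4) (`|_| ^+ 2) => a b c; lra.
Qed.

End ReflectionOrbit.

Lemma natr_eventually_ge (a : R) : exists J, forall m, (J <= m)%N -> a <= m.+1%:R.
Proof.
exists (Num.bound `|a|) => m hm; apply: (le_trans (ler_norm a)).
apply: (le_trans (ltW (archi_boundP (normr_ge0 a)))).
by rewrite ler_nat (leq_trans hm).
Qed.

Lemma le_of_pow4 (a e K : R) : 0 <= a -> 0 < e -> 0 < K ->
  K * a ^+ 4 <= e ^+ 4 * K -> a <= e.
Proof.
move=> a0 e0 K0 h; rewrite -(@ler_pXn2r _ 4) ?nnegrE ?(ltW e0)//.
by rewrite -(ler_pM2l K0) [leRHS]mulrC.
Qed.

(** The rank [J] depends on [d] and [e] only: this uniformity in the base point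
    and in the starting point is what allows a bound on the number of inner steps
    to be fixed in advance. One-step displacements would not do, since the orbit
    may oscillate between two points with the same shadow. *)
Lemma reflection_uniform (d e : R) : 0 <= d -> 0 < e -> exists J, forall m x' p v z0,
  (J <= m)%N -> multiplier_pair x' p v -> `|z0 - (p - v)| <= d ->
  `|S x' (iter m (Refl x') z0) - p| <= e.
Proof.
move=> d0 e0; have [J hJ] := natr_eventually_ge (6 * d ^+ 4 / e ^+ 4).
exists J => m x' p v z0 Jm pv hz; have h := shadow_rate pv hz m.
apply: (le_of_pow4 (normr_ge0 _) e0 (ltr0Sn R m)).
apply: (le_trans h); have := hJ m Jm.
by rewrite ler_pdivrMr ?exprn_gt0// [X in _ <= X -> _]mulrC.
Qed.

Lemma relaxation_identity (a r c : H) (t : R) :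
  `|a + t *: (r - a) - c| ^+ 2 + t * (1 - t) * `|r - a| ^+ 2
    = (1 - t) * `|a - c| ^+ 2 + t * `|r - c| ^+ 2.
Proof. by rewrite -!ip_norm; ip_expand ip; ring. Qed.

Fixpoint relaxed_orbit (theta : nat -> R) x' z0 m :=
  if m is m'.+1 then
    let z := relaxed_orbit theta x' z0 m' in z + theta m' *: (Refl x' z - z)
  else z0.

Section Relaxed.
Variables (theta : nat -> R) (theta_low : R) (theta_low_gt0 : 0 < theta_low).
Hypothesis theta_bounds : forall m, theta_low <= theta m <= 1.
Let s m := \sum_(i < m) (1 - theta i).

Section RelaxedOrbit.
Variables (x' p v : H) (pv : multiplier_pair x' p v).
Let zs := p - v.
Variable (z0 : H) (d : R) (d_ge : `|z0 - zs| <= d).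
Let z m := relaxed_orbit theta x' z0 m.
Let E m := `|Refl x' (z m) - z m|.

Let d0 : 0 <= d. Proof. exact: le_trans d_ge. Qed.

Lemma relaxed_fejer m : `|z m.+1 - zs| ^+ 2 + theta m * (1 - theta m) * E m ^+ 2
  <= `|z m - zs| ^+ 2.
Proof.
have h : `|Refl x' (z m) - zs| ^+ 2 <= `|z m - zs| ^+ 2.
  by rewrite lerXn2r ?nnegrE//; exact: reflect_dist pv.1 pv.2 _.
have /andP[t1 t2] := theta_bounds m.
have /(ler_wpM2l (ltW (lt_le_trans theta_low_gt0 t1))) := h.
rewrite /E [z m.+1]/= -/(z m) relaxation_identity; lra.
Qed.

Lemma relaxed_dist m : `|z m - zs| <= d.
Proof.
elim: m => [//|m ih]; apply: le_trans ih.
have /andP[t1 t2] := theta_bounds m; have t0 := lt_le_trans theta_low_gt0 t1.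
rewrite -(@ler_pXn2r _ 2) ?nnegrE//; have := relaxed_fejer m.
have : 0 <= theta m * (1 - theta m) * E m ^+ 2.
  by rewrite mulr_ge0 ?sqr_ge0// mulr_ge0 ?subr_ge0// ltW.
lra.
Qed.

Lemma residual_le m : E m <= 2 * d.
Proof.
have := reflect_dist ip_norm C_nonempty C_closed C_convex f_Gamma0 pv.1 pv.2 (z m).
have := relaxed_dist m; have := ler_distD zs (Refl x' (z m)) (z m).
by rewrite (distrC zs) -/zs /E; lra.
Qed.

(** Nonexpansiveness gives this for every relaxation parameter, although the
    operators change from one step to the next. *)
Lemma residual_noninc m k : (m <= k)%N -> E k <= E m.
Proof.
elim: k => [|k ih]; first by rewrite leqn0 => /eqP->.
rewrite leq_eqVlt => /predU1P[->//|]; rewrite ltnS => /ih; apply: le_trans.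
have /andP[t1 t2] := theta_bounds k; have t0 := lt_le_trans theta_low_gt0 t1.
have := reflect_nonexpansive ip_norm C_nonempty C_closed C_convex f_Gamma0 x' (z k.+1) (z k).
have -> : z k.+1 - z k = theta k *: (Refl x' (z k) - z k) by rewrite [z k.+1]/=; vec ip ip_norm.
rewrite normrZ gtr0_norm// -/(E k) => h1.
have := ler_distD (Refl x' (z k)) (Refl x' (z k.+1)) (z k.+1).
have -> : Refl x' (z k) - z k.+1 = (1 - theta k) *: (Refl x' (z k) - z k).
  by rewrite [z k.+1]/=; vec ip ip_norm.
rewrite normrZ ger0_norm ?subr_ge0// -/(E k) -/(E k.+1); lra.
Qed.

(** Each step lowers the squared distance to the fixed point by [theta * (1 -
    theta)] times the squared residual. *)
Lemma residual_rate m : theta_low * s m * E m ^+ 2 <= d ^+ 2.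
Proof.
suff : theta_low * (\sum_(i < m) (1 - theta i) * E i ^+ 2) + `|z m - zs| ^+ 2 <= d ^+ 2.
  have : s m * E m ^+ 2 <= \sum_(i < m) (1 - theta i) * E i ^+ 2.
    rewrite mulr_suml; apply: ler_sum => i _; apply: ler_wpM2l.
      by rewrite subr_ge0; have /andP[] := theta_bounds i.
    by rewrite lerXn2r ?(residual_noninc (ltnW (ltn_ord i)))// nnegrE; exact: normr_ge0.
  move=> /(ler_wpM2l (ltW theta_low_gt0)); have := sqr_ge0 `|z m - zs|; lra.
elim: m => [|m ih]; first by rewrite big_ord0 mulr0 add0r lerXn2r ?nnegrE.
rewrite big_ord_recr/= mulrDr; have := relaxed_fejer m; move: ih.
have /andP[t1 t2] := theta_bounds m.
have : theta_low * ((1 - theta m) * E m ^+ 2) <= theta m * (1 - theta m) * E m ^+ 2.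
  rewrite -mulrA; apply: ler_wpM2r => //.
  by rewrite mulr_ge0 ?sqr_ge0// subr_ge0.
lra.
Qed.

Lemma shadow_residual m : 2 * `|S x' (z m) - p| ^+ 2 <= d * E m.
Proof.
have f1 := reflect_fejer ip_norm C_nonempty C_closed C_convex f_Gamma0 pv.1 pv.2 (z m).
apply: (@half_gap_le _ `|z m - zs| `|Refl x' (z m) - zs|); rewrite ?relaxed_dist//.
  by rewrite /E (distrC (Refl x' (z m)) (z m)) ler_distD.
  by apply: le_trans (relaxed_dist m); exact: reflect_dist pv.1 pv.2 _.
exact: normr_ge0.
Qed.

(** An under-relaxed step differs from the reflection by [1 - theta] times the
    residual, and the reflection does not amplify earlier differences. *)
Lemma relaxed_vs_reflection m0 j :
  `|z (m0 + j) - iter j (Refl x') (z m0)| <= (s (m0 + j) - s m0) * (2 * d).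
Proof.
elim: j => [|j ih]; first by rewrite addn0 !subrr normr0 mul0r.
rewrite addnS [s _.+1]/s big_ord_recr/= -/(s (m0 + j)).
have := reflect_nonexpansive ip_norm C_nonempty C_closed C_convex f_Gamma0 x'
  (z (m0 + j)) (iter j (Refl x') (z m0)).
have /andP[t1 t2] := theta_bounds (m0 + j).
have : `|z (m0 + j).+1 - Refl x' (z (m0 + j))| <= (1 - theta (m0 + j)) * (2 * d).
  have -> : z (m0 + j).+1 - Refl x' (z (m0 + j))
          = - ((1 - theta (m0 + j)) *: (Refl x' (z (m0 + j)) - z (m0 + j))).
    by rewrite [z (_ + _).+1]/=; vec ip ip_norm.
  rewrite normrN normrZ ger0_norm ?subr_ge0//; apply: ler_wpM2l; rewrite ?subr_ge0//.
  exact: residual_le.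
have := ler_distD (Refl x' (z (m0 + j))) (z (m0 + j).+1) (Refl x' (iter j (Refl x') (z m0))).
rewrite /z in ih *; lra.
Qed.

End RelaxedOrbit.

(** Either the defects [1 - theta] have an infinite sum, and the residuals tend to
    0 uniformly, or they are summable, and after finitely many steps the orbit
    stays close to an orbit of the unrelaxed reflection. *)
Lemma relaxed_uniform (d e : R) : 0 <= d -> 0 < e -> exists J, forall m x' p v z0,
  (J <= m)%N -> multiplier_pair x' p v -> `|z0 - (p - v)| <= d ->
  `|S x' (relaxed_orbit theta x' z0 m) - p| <= e.
Proof.
move=> d0 e0.
have sD m k : s m <= s (m + k).
  elim: k => [|k]; first by rewrite addn0.
  rewrite addnS /s big_ord_recr/= => h; rewrite (le_trans h)// lerDl subr_ge0.
  by have /andP[] := theta_bounds (m + k).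
have [bnd|unb] := pselect (has_ubound (range s)).
  (* From [m0] on, the defects sum up to at most [del], which costs [e / 2]. *)
  have sS : has_sup (range s) by split=> //; exists (s 0); exists 0%N.
  pose del := e / (4 * (d + 1)).
  have del0 : 0 < del by rewrite divr_gt0// mulr_gt0// ltr_wpDl.
  have [_ [m0 _ <-] hm0] := sup_adherent del0 sS.
  have e2 : 0 < e / 2 by rewrite divr_gt0.
  have [J hJ] := reflection_uniform d0 e2.
  exists (m0 + J)%N => m x' p v z0 hm pv hz.
  have mE : m = (m0 + (m - m0))%N by rewrite subnKC// (leq_trans _ hm)// leq_addr.
  have Jm : (J <= m - m0)%N by rewrite leq_subRL ?(leq_trans _ hm)// leq_addr.
  have h1 := hJ _ _ _ _ _ Jm pv (relaxed_dist pv hz m0).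
  have h2 := relaxed_vs_reflection pv hz m0 (m - m0); rewrite -mE in h2.
  have h3 := shadow_nonexpansive ip_norm C_nonempty C_closed C_convex x'
    (relaxed_orbit theta x' z0 m)
    (iter (m - m0) (Refl x') (relaxed_orbit theta x' z0 m0)).
  have h4 : s m <= sup (range s) by apply: ub_le_sup => //; exists m.
  have h5 : (s m - s m0) * (2 * d) <= del * (2 * d).
    by apply: ler_wpM2r; [rewrite mulr_ge0|lra].
  have h6 : del * (2 * d) <= e / 2.
    rewrite /del mulrAC ler_pdivrMr ?mulr_gt0 ?ltr_wpDl//; nra.
  have := ler_distD (S x' (iter (m - m0) (Refl x') (relaxed_orbit theta x' z0 m0)))
    (S x' (relaxed_orbit theta x' z0 m)) p.
  lra.
(* The threshold is where the bound on the residual, of order [1 / s J], yields an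
   error of the shadow at most [e]. *)
have [J hJ] : exists J, (d ^+ 4 / theta_low / e ^+ 4) + 1 < s J.
  apply: contrapT => /forallNP hN; apply: unb.
  by exists (d ^+ 4 / theta_low / e ^+ 4 + 1) => _ [m _ <-]; rewrite leNgt; apply/negP.
exists J => m x' p v z0 Jm pv hz.
have sJm : s J <= s m by rewrite -(subnKC Jm).
set K := d ^+ 4 / theta_low / e ^+ 4 in hJ.
have K0 : 0 <= K by rewrite !divr_ge0 ?exprn_ge0 ?(ltW theta_low_gt0) ?(ltW e0).
have sm0 : 0 < s m by lra.
have K4 : 0 < 4 * theta_low * s m by rewrite !mulr_gt0.
apply: (le_of_pow4 (normr_ge0 _) e0 K4).
have h1 := shadow_residual pv hz m; have h2 := residual_rate pv hz m.
set phi := `|S x' _ - p| in h1 *; set E := `|_| in h1 h2.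
have a1 : 4 * phi ^+ 4 <= d ^+ 2 * E ^+ 2.
  have : (2 * phi ^+ 2) ^+ 2 <= (d * E) ^+ 2.
    by rewrite lerXn2r ?nnegrE ?mulr_ge0 ?normr_ge0.
  lra.
have a2 := ler_wpM2l (sqr_ge0 d) h2.
have d4 : d ^+ 2 * d ^+ 2 = d ^+ 4 by rewrite -exprD.
rewrite d4 in a2.
have a3 := ler_wpM2l (ltW (mulr_gt0 theta_low_gt0 sm0)) a1.
have a4 : d ^+ 4 <= theta_low * e ^+ 4 * s m.
  rewrite -ler_pdivrMl ?mulr_gt0 ?exprn_gt0//.
  have -> : (theta_low * e ^+ 4)^-1 * d ^+ 4 = K.
    by rewrite /K; field; rewrite !gt_eqF ?exprn_gt0.
  lra.
have e40 : 0 <= e ^+ 4 * (4 * theta_low * s m) by rewrite !mulr_ge0 ?exprn_ge0 ?ltW.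
have : d ^+ 4 <= 4 * (theta_low * e ^+ 4 * s m) by have := exprn_ge0 4 d0; lra.
lra.
Qed.

End Relaxed.
End InnerLoop.

(** * Convex functions with a Lipschitz gradient *)

Section SmoothConvex.
Context {R : realType} {H : completeNormedModType R} (ip : {dot H for (@idfun R)}).
Hypothesis ip_norm : induces_norm ip.
Context (g : H -> R) (dg : H -> H) (dg_gradient : is_gradient ip g dg).
Context (beta : R) (beta_gt0 : 0 < beta) (dg_lipschitz : beta.-lipschitz dg).
Implicit Types (x y z d : H).

Lemma gradient_lipschitz x y : `|dg x - dg y| <= beta * `|x - y|.
Proof. by exact: (dg_lipschitz (x := (x, y)) (conj I I)). Qed.

(** The derivative along a line is literally the directional derivative, up to the
    translation of the base point. *)
Lemma is_derive_line x d (t : R) :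
  is_derive t 1 (fun t : R => g (x + t *: d)) (ip (dg (x + t *: d)) d).
Proof.
have [gdiff gE] := dg_gradient (x + t *: d).
have gd := diff_derivable (v := d) gdiff.
have lineE :
   (fun h : R => h^-1 *: (((fun t : R => g (x + t *: d)) \o shift t) (h *: 1)
                          - g (x + t *: d)))
   = (fun h : R => h^-1 *: ((g \o shift (x + t *: d)) (h *: d) - g (x + t *: d))).
  apply/funext => h /=; congr (_ *: (g _ - _)).
  by rewrite [h *: 1]mulr1 scalerDl addrCA.
apply: DeriveDef; first by rewrite /derivable lineE.
by rewrite /derive lineE -gE -(deriveE d gdiff).
Qed.

Lemma descent_aux (c : R) x d : (forall t, 0 < t < 1 ->
    ip (dg (x + t *: d)) d - ip (dg x) d <= t * c) ->
  g (x + d) <= g x + ip (dg x) d + c / 2.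
Proof.
move=> hc.
pose psi : R -> R := (fun t : R => g (x + t *: d))
  - (ip (dg x) d \*: (@id R) + (c / 2) \*: ((@id R) ^+ 2)).
pose dpsi (t : R) := ip (dg (x + t *: d)) d - (ip (dg x) d + t * c).
have dpsiP (t : R) : is_derive t (1 : R) (psi : R -> R) (dpsi t).
  have h := is_derive_line x d t.
  apply: is_derive_eq; rewrite /dpsi /= /GRing.scale/= expr1 !mulr1; by field.
have cont : {within `[0, 1], continuous psi}.
  apply: continuous_subspaceT => u; apply: differentiable_continuous.
  by apply/derivable1_diffP; have [] := dpsiP u.
have [s0] := @MVT _ psi dpsi 0 1 ltr01 (fun u _ => dpsiP u) cont.
rewrite in_itv/= => s01; have := hc s0 s01.
have -> : psi 1 = g (x + d) - (ip (dg x) d + c / 2).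
  by rewrite /psi/= !fctE /= scale1r expr1n /GRing.scale/= !mulr1.
have -> : psi 0 = g x.
  by rewrite /psi/= !fctE /= scale0r expr0n /GRing.scale/= !mulr0 !addr0 subr0.
by rewrite /dpsi; lra.
Qed.

Lemma descent x d : g (x + d) <= g x + ip (dg x) d + beta / 2 * `|d| ^+ 2.
Proof.
rewrite mulrAC; apply: descent_aux => t /andP[t0 _].
rewrite -ipNl -ipDl; apply: (le_trans (ip_le_norm ip_norm _ _)).
have := ler_wpM2r (normr_ge0 d) (gradient_lipschitz (x + t *: d) x).
rewrite addrAC subrr add0r normrZ gtr0_norm// => /le_trans; apply.
by rewrite expr2; lra.
Qed.

Hypothesis g_Gamma0 : Gamma0 (EFin \o g).

Lemma real_convex x y t : 0 < t < 1 ->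
  g (t *: x + (1 - t) *: y) <= t * g x + (1 - t) * g y.
Proof.
move=> t01; have gx z : dom (EFin \o g) z by rewrite /dom/= ltry.
by have [] := Gamma0_convex_fine g_Gamma0 (gx x) (gx y) t01.
Qed.

(** Convexity at the midpoint of [x + t d] and [x - t d] turns the upper descent
    estimate at [x - t d] into a lower one at [x + t d]. *)
Lemma gradient_inequality x d : g x + ip (dg x) d <= g (x + d).
Proof.
apply: (@le_of_small_perturbation _ _ _ (beta / 2 * `|d| ^+ 2)) => t t01.
have half : 0 < (2^-1 : R) < 1 by rewrite invr_gt0 ltr0n invf_lt1 ?ltr1n.
have := real_convex (x + t *: d) (x + - t *: d) half.
have -> : 2^-1 *: (x + t *: d) + (1 - 2^-1) *: (x + - t *: d) = x by vec ip ip_norm.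
have := real_convex (x + d) x t01.
have -> : t *: (x + d) + (1 - t) *: x = x + t *: d by vec ip ip_norm.
have := descent x (- t *: d); rewrite ipZr.
have -> : `|- t *: d| ^+ 2 = t ^+ 2 * `|d| ^+ 2.
  by rewrite normrZ exprMn real_normK ?num_real ?sqrrN.
move=> h1 h2 h3; have t0 : 0 < t by case/andP: t01.
by rewrite -(ler_pM2l t0); lra.
Qed.

(** The point [y + w] minimizes the quadratic upper bound at [y] of [g] minus its
    tangent at [x]. *)
Lemma gradient_gap x y :
  g x + ip (dg x) (y - x) + (2 * beta)^-1 * `|dg y - dg x| ^+ 2 <= g y.
Proof.
(* The gradient step of length [1 / beta]. *)
pose w := - beta^-1 *: (dg y - dg x).
have := descent y w; have := gradient_inequality x (y + w - x).
have -> : x + (y + w - x) = y + w by vec ip ip_norm.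
have b0 : beta != 0 by rewrite gt_eqF.
have -> : beta / 2 * `|w| ^+ 2 = (2 * beta)^-1 * `|dg y - dg x| ^+ 2.
  by rewrite /w normrZ exprMn real_normK ?num_real// sqrrN; field.
have : ip (dg y) w - ip (dg x) w = - (2 * ((2 * beta)^-1 * `|dg y - dg x| ^+ 2)).
  by rewrite /w -!ip_norm; ip_expand ip; field.
by ip_expand ip; lra.
Qed.

(** The theorem of Baillon and Haddad: the two gaps of the previous inequality add
    up. The constant [beta] is what permits step sizes up to [2 / beta]. *)
Lemma gradient_cocoercive x y :
  `|dg x - dg y| ^+ 2 <= beta * ip (dg x - dg y) (x - y).
Proof.
have h1 := gradient_gap x y; have h2 := gradient_gap y x; rewrite distrC in h1.
have b0 : 0 < beta^-1 by rewrite invr_gt0.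
rewrite -(ler_pM2l b0) [leRHS]mulKf ?gt_eqF//.
have -> : beta^-1 = (2 * beta)^-1 + (2 * beta)^-1 by field; rewrite gt_eqF.
move: h1 h2; ip_expand ip; move: ((2 * beta)^-1) (`|_| ^+ 2) => b e; lra.
Qed.

End SmoothConvex.

(** * Weak limits and the lemma of Opial *)

Section WeakLimits.
Context {R : realType} {H : completeNormedModType R} (ip : {dot H for (@idfun R)}).
Hypothesis ip_norm : induces_norm ip.
Implicit Types (x y z u v : H).

(** The representing vector is the proximal point of [- L] at 0. *)
Lemma riesz (L : H -> R) (K : R) :
  (forall u v, L (u + v) = L u + L v) -> (forall a u, L (a *: u) = a * L u) ->
  (forall u, `|L u| <= K * `|u|) -> exists l, forall v, L v = ip l v.
Proof.
move=> LD LZ LK.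
have LN u : L (- u) = - L u by rewrite -scaleN1r LZ mulN1r.
have Lcont : continuous L.
  move=> u; apply/cvgrPdist_lt => e e0.
  have K1 : 0 < `|K| + 1 by rewrite ltr_wpDl.
  near=> w; rewrite -LN -LD; apply: (le_lt_trans (LK _)).
  have : `|u - w| < e / (`|K| + 1).
    by near: w; apply: cvgr_dist_lt => //; rewrite divr_gt0.
  rewrite ltr_pdivlMr//; have := ler_norm K; have := normr_ge0 (u - w); nra.
have h0 : Gamma0 (fun y => (- L y)%:E).
  split.
  - by move=> y; rewrite ltNyr.
  - by exists 0; rewrite /dom/= ltry.
  - move=> y z t _; rewrite -!EFinM -EFinD lee_fin LD !LZ; lra.
  - move=> y a; rewrite lte_fin => ay.
    exists [set z | a < - L z] => //.
    have : (fun z => - L z) @ y --> - L y by apply: cvgN; exact: Lcont.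
    by move/(_ [set z | a < z]); apply; exact: (lt_nbhsr ay).
have [_] := prox_subgradient ip_norm 0 h0; set p := prox _ _ => pmin.
have le z : L z <= ip p z.
  have := pmin (p + z); rewrite -EFinD lee_fin LD addrAC subrr !add0r ipNl; lra.
exists p => v; apply/eqP; rewrite eq_le le /=.
by have := le (- v); rewrite LN ipNr lerN2.
Unshelve. all: end_near. Qed.

Definition weak_limit (U : set_system nat) (x : nat -> H) l :=
  forall v, (fun n => ip (x n) v) @ U --> ip l v.

(** Along an ultrafilter every bounded scalar sequence converges, so the limits of
    the inner products exist for all test vectors at once and define a bounded
    linear form. *)
Lemma bounded_weak_limit (U : set_system nat) (x : nat -> H) K :
  UltraFilter U -> (forall n, `|x n| <= K) -> exists l, weak_limit U x l.
Proof.
move=> UU xK; have UP : ProperFilter U by exact: ultra_proper.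
have /choice[L LP] v : exists a, (fun n => ip (x n) v) @ U --> (a : R).
  pose B := K * `|v|.
  have FU : UltraFilter ((fun n => ip (x n) v) @ U).
    split; first exact: fmap_proper_filter.
    move=> G PG FG; apply/seteqP; split=> // A GA.
    have [//|UA] := in_ultra_setVsetC ((fun n => ip (x n) v) @^-1` A) UU.
    exfalso; have : G (~` A) by exact: FG.
    by move=> /(filterI GA); rewrite setICr; exact: filter_not_empty.
  have := @segment_compact R (- B) B; rewrite compact_ultra => /(_ _ FU).
  case=> [|a [_ ?]]; last by exists a.
  apply: (@filterE _ U _) => n /=; rewrite in_itv/= -ler_norml.
  by apply: (le_trans (norm_ip_le ip_norm _ _)); apply: ler_wpM2r.
have uniq (a b : R) (s : nat -> R) : s @ U --> a -> s @ U --> b -> a = b.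
  by move=> sa sb; apply: (cvg_unique _ sa sb).
have [|||l lP] := @riesz L K.
- move=> u v; apply: (uniq _ _ _ (LP (u + v))).
  by under eq_fun do rewrite ipDr; exact: cvgD.
- move=> a u; apply: (uniq _ _ _ (LP (a *: u))).
  by under eq_fun do rewrite ipZr; apply: cvgM => //; exact: cvg_cst.
- move=> u; apply: (cvgr_to_le (cvg_norm (LP u))); apply: filterE => n.
  by apply: (le_trans (norm_ip_le ip_norm _ _)); apply: ler_wpM2r.
by exists l => v; rewrite -lP.
Qed.

Lemma weak_limit_strong U (FU : ProperFilter U) (x w : nat -> H) l w0 K :
  (forall n, `|x n| <= K) -> weak_limit U x l -> w @ U --> w0 ->
  (fun n => ip (x n) (w n)) @ U --> ip l w0.
Proof.
move=> xK xl ww.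
have -> : (fun n => ip (x n) (w n)) = (fun n => ip (x n) w0 + ip (x n) (w n - w0)).
  by apply/funext => n; rewrite -ipDr addrC subrK.
rewrite -[X in _ --> X]addr0; apply: cvgD; first exact: xl.
have K0 : 0 <= K by exact: le_trans (xK 0%N).
apply/norm_cvg0P; apply: (@squeeze_cvgr _ _ _ _ (cst 0) (fun n => K * `|w n - w0|)).
- apply: filterE => n; rewrite normr_ge0/=.
  by apply: (le_trans (norm_ip_le ip_norm _ _)); apply: ler_wpM2r.
- exact: cvg_cst.
- rewrite -(mulr0 K); apply: cvgM; first exact: cvg_cst.
  rewrite -(@normr0 _ H) -(subrr w0); apply: cvg_norm; apply: cvgB => //; exact: cvg_cst.
Qed.

(** If [l] and [l0] are two weak limits, the convergence of both distances makes
    the inner products with [l - l0] converge, which forces [l = l0]. A sequence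
    failing to converge weakly to [l0] would have another limit along some
    ultrafilter. *)
Lemma opial (S : set H) (x : nat -> H) K : (forall n, `|x n| <= K) ->
  (forall s, S s -> cvgn (fun n => `|x n - s|)) ->
  (forall U l, UltraFilter U -> \oo `<=` U -> weak_limit U x l -> S l) ->
  exists2 l, S l & weakly_converges ip x l.
Proof.
move=> xK xS clus.
have [U0 [UU0 sU0]] := ultraFilterLemma eventually_filter.
have [l0 hl0] := bounded_weak_limit UU0 xK.
have Sl0 := clus _ _ UU0 sU0 hl0.
exists l0 => // v; apply: contrapT => ncvg.
have [A nA nAx] : exists2 A, nbhs (ip l0 v) A & ~ \oo ((fun n => ip (x n) v) @^-1` A).
  apply: contrapT => h; apply: ncvg => A nA; apply: contrapT => nAx.
  by apply: h; exists A.
(* An ultrafilter concentrated on the ranks that stay away from [ip l0 v]. *)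
pose B := (fun n => ip (x n) v) @^-1` A.
have GP : ProperFilter (within (~` B) \oo).
  apply: Build_ProperFilter_ex => P; rewrite /within/= => hP.
  apply: contrapT => /forallNP nP; apply: nAx; apply: filterS hP => n hn.
  by apply: contrapT => nB; exact: nP n (hn nB).
have [U [UU sU]] := ultraFilterLemma GP.
have sU' : \oo `<=` U by move=> P hP; apply: sU; apply: filterS hP.
have UP : ProperFilter U by exact: ultra_proper.
have UP0 : ProperFilter U0 by exact: ultra_proper.
have [l hl] := bounded_weak_limit UU xK.
have Sl := clus _ _ UU sU' hl.
have /cvg_ex[c hc] : cvgn (fun n => ip (x n) (l - l0)).
  have -> : (fun n => ip (x n) (l - l0))
    = (fun n => 2^-1 * (`|x n - l0| ^+ 2 - `|x n - l| ^+ 2 + (`|l| ^+ 2 - `|l0| ^+ 2))).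
    by apply/funext => n; rewrite -!ip_norm; ip_expand ip; field.
  have c1 := xS _ Sl0; have c2 := xS _ Sl.
  apply/cvg_ex; eexists; apply: cvgM; first exact: cvg_cst.
  by apply: cvgD; [apply: cvgB; rewrite ?expr2; apply: cvgM;
    (exact: c1 || exact: c2)|exact: cvg_cst].
have hcU (V : set_system nat) : \oo `<=` V -> (fun n => ip (x n) (l - l0)) @ V --> c.
  by move=> sV A1 nA1; apply: sV; exact: hc.
have e1 : c = ip l (l - l0) := cvg_unique (@Rhausdorff R) (hcU _ sU') (hl _).
have e2 : c = ip l0 (l - l0) := cvg_unique (@Rhausdorff R) (hcU _ sU0) (hl0 _).
have ll : l = l0 by apply: (ip_vec_eq ip_norm); rewrite ipDl ipNl -e1 -e2 subrr.
have UB : U B by apply: (hl v); rewrite ll.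
have UnB : U (~` B) by apply: sU; exact: withinT.
have : U (B `&` ~` B) by exact: filterI.
by rewrite setICr; exact: filter_not_empty.
Qed.

End WeakLimits.

(** Adding the tail [2 * 2^-1 ^+ n] of the errors makes the sequence
    nonincreasing. *)
Lemma quasi_fejer_cvg {R : realType} (a : nat -> R) :
  (forall n, 0 <= a n) -> (forall n, a n.+1 <= a n + 2^-1 ^+ n) -> cvgn a.
Proof.
move=> a0 astep; pose e n : R := 2 * 2^-1 ^+ n.
have ecvg : e @ \oo --> (0 : R).
  rewrite -(mulr0 2); apply: cvgM; first exact: cvg_cst.
  by apply: cvg_expr; rewrite ger0_norm ?invf_lt1 ?ltr1n ?invr_ge0.
have : cvgn (fun n => a n + e n).
  apply: nonincreasing_is_cvgn.
    apply/nonincreasing_seqP => n; rewrite /e exprS mulrA mulfV// mul1r.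
    have := astep n; lra.
  by exists 0 => _ [n _ <-]; rewrite addr_ge0// mulr_ge0// exprn_ge0// invr_ge0.
move=> /cvg_ex[l hl]; apply/cvg_ex; exists (l - 0).
have -> : a = (fun n => a n + e n - e n) by apply/funext => n; rewrite addrK.
exact: cvgB.
Qed.

Lemma quasi_fejer_bounded {R : realType} (a : nat -> R) :
  (forall n, a n.+1 <= a n + 2^-1 ^+ n) -> forall n, a n <= a 0%N + 2.
Proof.
move=> astep n; suff : a n + 2 * 2^-1 ^+ n <= a 0%N + 2.
  have : 0 <= (2^-1 : R) ^+ n by rewrite exprn_ge0// invr_ge0.
  move: (2^-1 ^+ n) => e; lra.
elim: n => [|n ih]; first by rewrite expr0 mulr1.
by have := astep n; rewrite exprS mulrA mulfV// mul1r; lra.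
Qed.

(** * One outer step *)

Section ConstrainedSubgradients.
Context {R : realType} {H : completeNormedModType R} (ip : {dot H for (@idfun R)}).
Hypothesis ip_norm : induces_norm ip.
Context (C : set H) (f : H -> \bar R).
Implicit Types (x y z p q u v w : H).

(** A subgradient of [f] plus the indicator of [C], expressed by real numbers. *)
Definition constrained_subgradient p w := [/\ C p, f p \is a fin_num
  & forall y, C y -> f y \is a fin_num -> fine (f p) + ip w (y - p) <= fine (f y)].

Lemma constrained_subgradient_monotone p q u v :
  constrained_subgradient p u -> constrained_subgradient q v -> 0 <= ip (u - v) (p - q).
Proof.
move=> [Cp fp hp] [Cq fq hq]; have := hp q Cq fq; have := hq p Cp fp.
by ip_expand ip; lra.
Qed.

(** The normal vector [x - p - v] is discarded by testing at points of [C] only. *)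
Lemma constrained_subgradient_of_multiplier c x p v : 0 < c ->
  subgradient ip (fun y => (c%:E * f y)%E) p v -> normal_cone ip C p (x - p - v) ->
  constrained_subgradient p (c^-1 *: (x - p)).
Proof.
move=> c0 /(subgradient_scale c0) sp [Cp np].
split=> [//||y Cy fy]; first exact: sp.1.
apply: le_trans (subgradient_fine sp fy); rewrite lerD2l !ipZl.
rewrite ler_pM2l ?invr_gt0//; have := np y Cy; ip_expand ip; lra.
Qed.

Hypotheses (C_nonempty : C !=set0) (C_closed : closed C) (C_convex : convex_set C).
Hypothesis f_Gamma0 : Gamma0 f.
Hypothesis Cf_regular : regular_pair ip C (dom f).

Lemma constrained_resolvent x : exists p, constrained_subgradient p (x - p).
Proof.
have [K hK] := multiplier_exists ip_norm C_nonempty C_closed C_convex f_Gamma0 Cf_regular `|x|.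
have [p [v [sp [Cp np] _]]] := hK x (lexx _).
exists p; split=> [//||y Cy fy]; first exact: sp.1.
apply: le_trans (subgradient_fine sp fy); rewrite lerD2l.
have := np y Cy; ip_expand ip; lra.
Qed.

Lemma constrained_subgradient_maximal p u :
  (forall y w, constrained_subgradient y w -> 0 <= ip (w - u) (y - p)) ->
  constrained_subgradient p u.
Proof.
move=> h; have [q hq] := constrained_resolvent (p + u).
have := h _ _ hq => h1.
have pq : p = q.
  apply: (ip_vec_eq ip_norm); apply/eqP; rewrite eq_le; apply/andP; split.
    by move: h1; ip_expand ip; lra.
  by rewrite ip_norm sqr_ge0.
by move: hq; rewrite -pq addrAC subrr add0r.
Qed.

Context (g : H -> R) (g_Gamma0 : Gamma0 (EFin \o g)).
Context (dg : H -> H) (dg_gradient : is_gradient ip g dg).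
Context (beta : R) (beta_gt0 : 0 < beta) (dg_lipschitz : beta.-lipschitz dg).

Local Notation Fg := (fun y => (f y + (g y)%:E)%E).

(** The smooth term is replaced by its descent estimate along the segment from [s]
    to [y], and the quadratic remainder disappears in the limit. *)
Lemma minimizer_optimality s : is_minimizer C Fg s -> constrained_subgradient s (- dg s).
Proof.
move=> [Cs smin]; have [p [Cp fp _]] := constrained_resolvent 0.
have [hoo _ _ _] := f_Gamma0.
have fs : f s \is a fin_num.
  have := smin p Cp; rewrite -[f p]fineK//; move: (hoo s); case: (f s) => //=.
split=> // y Cy fy.
have dy : dom f y by rewrite /dom/= ltey_eq fy.
have ds : dom f s by rewrite /dom/= ltey_eq fs.
apply: (@le_of_small_perturbation _ _ _ (beta / 2 * `|y - s| ^+ 2)) => t t01.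
have [dz fz] := Gamma0_convex_fine f_Gamma0 dy ds t01.
have := smin _ (convex_setP C_convex Cy Cs t01).
rewrite -[f s]fineK// -[f (_ + _)]fineK ?Gamma0_fin// -!EFinD lee_fin.
have -> : t *: y + (1 - t) *: s = s + t *: (y - s) by vec ip ip_norm.
have := descent ip_norm dg_gradient dg_lipschitz s (t *: (y - s)).
rewrite normrZ exprMn real_normK ?num_real//.
have t0 : 0 < t by case/andP: t01.
move: fz; have -> : t *: y + (1 - t) *: s = s + t *: (y - s) by vec ip ip_norm.
move=> h1 h2 h3; rewrite -(ler_pM2l t0); move: h1 h2 h3.
rewrite ipZr ipNl; move: (ip (dg s) (y - s)) (`|_| ^+ 2) => a b; lra.
Qed.

Lemma optimality_minimizer s : constrained_subgradient s (- dg s) -> is_minimizer C Fg s.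
Proof.
move=> [Cs fs hs]; split=> // y Cy; have [hoo _ _ _] := f_Gamma0.
have [fy|] := boolP (f y \is a fin_num); last first.
  by move: (hoo y); case: (f y) => //= _ _; rewrite addye// leey.
rewrite -[f s]fineK// -[f y]fineK// -!EFinD lee_fin.
have := gradient_inequality ip_norm dg_gradient dg_lipschitz g_Gamma0 s (y - s).
have := hs y Cy fy; have -> : s + (y - s) = y by vec ip ip_norm.
by rewrite ipNl; lra.
Qed.

(** Monotonicity bounds the distance of [p] to [s] by that of the two forward
    points, and cocoercivity of the gradient bounds the latter. *)
Lemma forward_backward_fejer c s x p : 0 < c ->
  constrained_subgradient s (- dg s) ->
  constrained_subgradient p (c^-1 *: (x - c *: dg x - p)) ->
  `|p - s| ^+ 2 + c * (2 / beta - c) * `|dg x - dg s| ^+ 2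
    + `|x - p - c *: (dg x - dg s)| ^+ 2 <= `|x - s| ^+ 2.
Proof.
move=> c0 ss sp; have := constrained_subgradient_monotone sp ss.
have -> : c^-1 *: (x - c *: dg x - p) - - dg s = c^-1 *: (x - p - c *: (dg x - dg s)).
  by apply: (ip_ext ip_norm) => w; rewrite ?(ipE ip); field; rewrite gt_eqF.
rewrite ipZl pmulr_rge0 ?invr_gt0// => h1.
have h2 := gradient_cocoercive ip_norm dg_gradient beta_gt0 dg_lipschitz g_Gamma0 x s.
have h3 : 2 / beta * `|dg x - dg s| ^+ 2 <= 2 * ip (dg x - dg s) (x - s).
  by rewrite mulrAC ler_pdivrMr//; lra.
have := ler_wpM2l (ltW c0) h3; move: h1.
set D := dg x - dg s; move: (2 / beta) => k.
have [r rE] : exists r, r = x - p - c *: D by exists (x - p - c *: D).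
rewrite -rE.
have -> : x - s = r + c *: D + (p - s) by rewrite rE; vec ip ip_norm.
move: (p - s) => e h4 h5.
have : `|r + c *: D + e| ^+ 2
  = `|r| ^+ 2 + `|e| ^+ 2 + 2 * ip r e - c ^+ 2 * `|D| ^+ 2
    + 2 * c * ip D (r + c *: D + e).
  by rewrite -!ip_norm; ip_expand ip; ring.
by lra.
Qed.

(** Over a ball of base points, the starting point of the inner loop stays at a
    bounded distance from the fixed point given by the multiplier, so one rank
    serves all of them. When the loop stops early, its last shadow is the exact
    constrained proximal point. *)
Lemma outer_step_uniform c (tau : nat -> nat -> R) lambda gamma tau_low n rho e :
  gamma n = c -> 0 < c -> 0 < tau_low -> (forall m, tau_low <= tau n m <= 2) -> 0 < e ->
  exists2 J, (0 < J)%N & forall M x x1, (J <= M)%N -> `|x| <= rho ->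
  outer_step C f dg gamma lambda tau n M x x1 ->
  exists p q, [/\ constrained_subgradient p (c^-1 *: (x - c *: dg x - p)),
    `|q - p| <= e & x1 = x + lambda n *: (q - x)].
Proof.
move=> gc c0 tl0 tauP e0.
set fc := fun y => (c%:E * f y)%E.
have fcG : Gamma0 fc by exact: Gamma0_scale.
have dom_fc : dom fc = dom f.
  apply/seteqP; split=> y; rewrite /dom/= /fc; have [hoo _ _ _] := f_Gamma0.
    by move: (hoo y); case: (f y) => //= _; rewrite gt0_muley ?lte_fin.
  by move: (hoo y); case: (f y) => [r||]//= _ _; rewrite ltry.
have reg : regular_pair ip C (dom fc) by rewrite dom_fc.
pose rho' := rho + c * (`|dg 0| + beta * rho).
have x'_le x : `|x| <= rho -> `|x - c *: dg x| <= rho'.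
  move=> xr; apply: (le_trans (ler_normB _ _)); apply: lerD => //.
  rewrite normrZ gtr0_norm//; apply: ler_wpM2l; first exact: ltW.
  have := gradient_lipschitz dg_lipschitz x 0; rewrite subr0.
  have := ler_normD (dg x - dg 0) (dg 0); rewrite subrK.
  have := ler_wpM2l (ltW beta_gt0) xr; lra.
have [K hK] := multiplier_exists ip_norm C_nonempty C_closed C_convex fcG reg rho'.
have [K0 hK0] := multiplier_exists ip_norm C_nonempty C_closed C_convex fcG reg 0.
have [p0 [v0 [sp0 np0 _]]] := hK0 0 ltac:(by rewrite normr0).
(* A bound for the distance from the starting point to the fixed point, through
   the values of the two proximal maps at 0. *)
pose d := `|2 * (`|prox fc 0| + rho') + rho' + (`|p0| + rho') + K|.
have th0 : 0 < tau_low / 2 by rewrite divr_gt0.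
have thP m : tau_low / 2 <= tau n m / 2 <= 1.
  have := tauP m; rewrite ler_pM2r ?invr_gt0//; lra.
have [J hJ] := relaxed_uniform ip_norm C_nonempty C_closed C_convex fcG th0 thP
  (normr_ge0 _ : 0 <= d) e0.
exists J.+1 => // M x x1 JM xr; rewrite /outer_step gc -/fc.
set x' := x - c *: dg x; move=> [z [zh [mn [mnM z0E zP [_ zend] ->]]]].
have x'r : `|x'| <= rho' by exact: x'_le.
have [p [v [sp np vK]]] := hK x' x'r.
have pv : multiplier_pair ip C fc x' p v by [].
exists p, (zh mn); split=> //.
  exact: (constrained_subgradient_of_multiplier c0 sp np).
have zorb m : (m <= mn)%N -> z m = relaxed_orbit C fc (fun m => tau n m / 2) x' (z 0%N) m.
  elim: m => [//|m ih] hm; have [zhE ->] := zP m (ltnW hm).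
  rewrite /= -ih ?(ltnW hm)// /reflect /prox_shadow /shadow -zhE.
  by vec ip ip_norm.
have [zhE zSE] := zP mn (leqnn _).
have zhS : zh mn = shadow C x' (z mn) by [].
case: zend => [zfix|mnE].
  suff -> : zh mn = p by rewrite subrr normr0 ltW.
  have tn0 : tau n mn != 0 by have /andP[h _] := tauP mn; rewrite gt_eqF// (lt_le_trans tl0).
  have yE : prox_shadow C fc x' (z mn) = zh mn.
    move: zSE; rewrite zfix => /eqP; rewrite -subr_eq0 opprD addrA subrr sub0r oppr_eq0.
    rewrite scaler_eq0 (negbTE tn0)/= subr_eq0 => /eqP <-.
    by rewrite /prox_shadow -zhS.
  have s1 := prox_shadow_subgradient ip_norm C fcG x' (z mn).
  have n1 := shadow_normal ip_norm C_nonempty C_closed C_convex x' (z mn).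
  rewrite yE -zhS in s1; rewrite -zhS in n1.
  have := subgradient_monotone s1 sp; have := normal_cone_monotone n1 np => h1 h2.
  apply: (ip_vec_eq ip_norm); apply/eqP; rewrite eq_le; apply/andP; split.
    by move: h1 h2; ip_expand ip; lra.
  by rewrite ip_norm sqr_ge0.
rewrite zhS zorb//; apply: (hJ mn x' p v) => //.
  by rewrite mnE -ltnS prednK// (leq_trans _ JM).
rewrite z0E; apply: le_trans (ler_norm _).
have a1 : `|prox fc x' - prox fc 0| <= rho'.
  by apply: le_trans x'r; have := prox_nonexpansive ip_norm x' 0 fcG; rewrite subr0.
have a2 : `|p - p0| <= rho'.
  apply: le_trans x'r; rewrite -[x']subr0; apply: (firm_nonexpansive ip_norm).
  have := subgradient_monotone sp sp0; have := normal_cone_monotone np np0.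
  by rewrite -ip_norm; ip_expand ip; lra.
have := ler_normB (2 *: prox fc x' - x') (p - v).
have := ler_normB (2 *: prox fc x') x'; rewrite normrZ ger0_norm//.
have := ler_normB p v; have := ler_normD (p - p0) p0; rewrite subrK.
have := ler_normD (prox fc x' - prox fc 0) (prox fc 0); rewrite subrK.
lra.
Qed.

End ConstrainedSubgradients.

(** * The forward-backward iteration with errors *)

Lemma cvg0_of_sqr_le {R : realType} {H : normedModType R} (w : nat -> H) (h : nat -> R) :
  h @ \oo --> 0 -> (forall n, `|w n| ^+ 2 <= h n) -> w @ \oo --> (0 : H).
Proof.
move=> h0 wh; apply/cvgrPdist_lt => e e0; near=> n.
rewrite sub0r normrN -(@ltr_pXn2r _ 2) ?nnegrE ?(ltW e0)//.
apply: (le_lt_trans (wh n)); apply: (le_lt_trans (ler_norm _)).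
rewrite -normrN -sub0r; near: n.
by move/cvgrPdist_lt : h0; apply; rewrite exprn_gt0.
Unshelve. all: end_near. Qed.

Section InexactForwardBackward.
Context {R : realType} {H : completeNormedModType R} (ip : {dot H for (@idfun R)}).
Hypothesis ip_norm : induces_norm ip.
Context (C : set H) (C_nonempty : C !=set0) (C_closed : closed C) (C_convex : convex_set C).
Context (f : H -> \bar R) (f_Gamma0 : Gamma0 f) (Cf_regular : regular_pair ip C (dom f)).
Context (g : H -> R) (g_Gamma0 : Gamma0 (EFin \o g)).
Context (dg : H -> H) (dg_gradient : is_gradient ip g dg).
Context (beta : R) (beta_gt0 : 0 < beta) (dg_lipschitz : beta.-lipschitz dg).
Local Notation csub := (constrained_subgradient ip C f).

(** The exact forward-backward point is no farther from a solution, and the error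
    of the shadow is scaled by [lambda]. *)
Lemma inexact_step c lambda e s x p q : 0 < c < 2 / beta -> 0 <= lambda <= 1 ->
  csub s (- dg s) -> csub p (c^-1 *: (x - c *: dg x - p)) -> `|q - p| <= e ->
  `|x + lambda *: (q - x) - s| <= `|x - s| + e.
Proof.
move=> /andP[c0 c2] /andP[l0 l1] ss sp qp.
have := forward_backward_fejer ip_norm g_Gamma0 dg_gradient beta_gt0 dg_lipschitz c0 ss sp => h.
have pe : `|p - s| <= `|x - s|.
  rewrite -(@ler_pXn2r _ 2) ?nnegrE//.
  have h1 : 0 <= c * (2 / beta - c) * `|dg x - dg s| ^+ 2.
    by rewrite mulr_ge0 ?sqr_ge0// mulr_ge0 ?subr_ge0// ltW.
  have := sqr_ge0 `|x - p - c *: (dg x - dg s)|; lra.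
have -> : x + lambda *: (q - x) - s
  = (1 - lambda) *: (x - s) + lambda *: (p - s) + lambda *: (q - p).
  by vec ip ip_norm.
have e0 : 0 <= e by exact: le_trans qp.
have := ler_normD ((1 - lambda) *: (x - s) + lambda *: (p - s)) (lambda *: (q - p)).
have := ler_normD ((1 - lambda) *: (x - s)) (lambda *: (p - s)).
rewrite !normrZ (ger0_norm l0) ger0_norm ?subr_ge0//.
have := ler_wpM2l l0 pe; have := ler_wpM2l l0 qp.
have := ler_wpM2r e0 l1; rewrite mul1r; lra.
Qed.

Context (gamma lambda : nat -> R) (gamma_low gamma_up lambda_low : R).
Hypotheses (gamma_low_gt0 : 0 < gamma_low) (gamma_up_lt : gamma_up < 2 / beta).
Hypothesis gamma_bounds : forall n, gamma_low <= gamma n <= gamma_up.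
Hypotheses (lambda_low_gt0 : 0 < lambda_low).
Hypothesis lambda_bounds : forall n, lambda_low <= lambda n <= 1.
Context (x p q : nat -> H).
Hypothesis p_csub : forall n, csub (p n) ((gamma n)^-1 *: (x n - gamma n *: dg (x n) - p n)).
Hypothesis q_near : forall n, `|q n - p n| <= 2^-1 ^+ n.
Hypothesis x_step : forall n, x n.+1 = x n + lambda n *: (q n - x n).

Let gamma_pos n : 0 < gamma n < 2 / beta.
Proof.
have /andP[h1 h2] := gamma_bounds n.
by rewrite (lt_le_trans gamma_low_gt0 h1) (le_lt_trans h2).
Qed.

Let lambda_pos n : 0 <= lambda n <= 1.
Proof.
by have /andP[h1 ->] := lambda_bounds n; rewrite (le_trans _ h1)// ltW.
Qed.

Lemma dist_step s n : csub s (- dg s) -> `|x n.+1 - s| <= `|x n - s| + 2^-1 ^+ n.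
Proof.
move=> ss; rewrite x_step.
exact: (inexact_step (gamma_pos n) (lambda_pos n) ss (p_csub n) (q_near n)).
Qed.

Section Residuals.
Variables (s : H) (ss : csub s (- dg s)).
Let r n := x n - p n - gamma n *: (dg (x n) - dg s).
Let B := `|x 0%N - s| + 2.

Let x_bound n : `|x n - s| <= B.
Proof. by apply: (quasi_fejer_bounded (a := fun n => `|x n - s|)) => k; exact: dist_step. Qed.

Let p_bound n : `|p n - s| <= `|x n - s|.
Proof.
have l1 : 0 <= (1 : R) <= 1 by rewrite ler01 lexx.
have pp : `|p n - p n| <= 0 by rewrite subrr normr0.
have := inexact_step (gamma_pos n) l1 ss (p_csub n) pp.
by rewrite scale1r (addrC (x n)) subrK addr0.
Qed.

Let kappa := gamma_low * (2 / beta - gamma_up).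
Let kappa_gt0 : 0 < kappa. Proof. by rewrite mulr_gt0// subr_gt0. Qed.
(** The last two terms come from [(`|y - s| + e) ^+ 2] with [`|y - s|] at most [B]
    and [e] the error at step [n]. *)
Let err n := `|x n - s| ^+ 2 - `|x n.+1 - s| ^+ 2 + (2 * B * 2^-1 ^+ n + 2^-1 ^+ n * 2^-1 ^+ n).

(** Since the distances to [s] converge, the right-hand side tends to 0. *)
Let descent_gap n :
  lambda_low * (kappa * `|dg (x n) - dg s| ^+ 2 + `|r n| ^+ 2) <= err n.
Proof.
have /andP[c0 c2] := gamma_pos n; have /andP[g1 g2] := gamma_bounds n.
have /andP[l1 l2] := lambda_bounds n; have l0 := lt_le_trans lambda_low_gt0 l1.
have fb := forward_backward_fejer ip_norm g_Gamma0 dg_gradient beta_gt0 dg_lipschitz c0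
  ss (p_csub n).
have kap : kappa * `|dg (x n) - dg s| ^+ 2 <=
  gamma n * (2 / beta - gamma n) * `|dg (x n) - dg s| ^+ 2.
  apply: ler_wpM2r; first exact: sqr_ge0.
  by apply: ler_pM; [exact: ltW|rewrite subr_ge0 ltW|by []|lra].
rewrite /err; set e := 2^-1 ^+ n; have e0 : 0 <= e by rewrite exprn_ge0 ?invr_ge0.
set y := x n + lambda n *: (p n - x n).
have y_sq : `|y - s| ^+ 2 <= `|x n - s| ^+ 2
    - lambda n * (kappa * `|dg (x n) - dg s| ^+ 2 + `|r n| ^+ 2).
  have := relaxation_identity ip_norm (x n) (p n) s (lambda n); rewrite -/y.
  have : 0 <= lambda n * (1 - lambda n) * `|p n - x n| ^+ 2.
    by rewrite mulr_ge0 ?sqr_ge0// mulr_ge0 ?subr_ge0// ltW.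
  have : lambda n * (`|p n - s| ^+ 2 + kappa * `|dg (x n) - dg s| ^+ 2 + `|r n| ^+ 2) <=
    lambda n * `|x n - s| ^+ 2.
    by apply: ler_wpM2l; [exact: ltW|rewrite /r; lra].
  lra.
have y_le : `|y - s| <= B.
  have -> : y - s = (1 - lambda n) *: (x n - s) + lambda n *: (p n - s).
    by rewrite /y; vec ip ip_norm.
  rewrite (le_trans (ler_normD _ _))// !normrZ (ger0_norm (ltW l0)) ger0_norm ?subr_ge0//.
  have := ler_wpM2l (ltW l0) (p_bound n); have := x_bound n; lra.
have step : `|x n.+1 - s| <= `|y - s| + e.
  have -> : x n.+1 - s = (y - s) + lambda n *: (q n - p n) by rewrite x_step /y; vec ip ip_norm.
  rewrite (le_trans (ler_normD _ _))// lerD2l normrZ (ger0_norm (ltW l0)).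
  by rewrite -[e]mul1r; apply: ler_pM; rewrite ?(ltW l0)//; exact: q_near.
have sq : `|x n.+1 - s| ^+ 2 <= (`|y - s| + e) ^+ 2.
  by rewrite lerXn2r ?nnegrE ?addr_ge0.
have ye : `|y - s| * e <= B * e by apply: ler_wpM2r.
have G0 : 0 <= kappa * `|dg (x n) - dg s| ^+ 2 + `|r n| ^+ 2.
  by rewrite addr_ge0 ?sqr_ge0// mulr_ge0 ?sqr_ge0// ltW.
have := ler_wpM2r G0 l1.
move: sq y_sq; move: (kappa * _ + _) => G; move: (`|x n.+1 - s| ^+ 2) => X1; lra.
Qed.

Let err_cvg : err @ \oo --> (0 : R).
Proof.
have /cvg_ex[a ha] : cvgn (fun n => `|x n - s|).
  by apply: quasi_fejer_cvg => n //; exact: dist_step.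
have e0 : (fun n => 2^-1 ^+ n) @ \oo --> (0 : R).
  by apply: cvg_expr; rewrite ger0_norm ?invf_lt1 ?ltr1n ?invr_ge0.
have a2 : (fun n => `|x n - s| ^+ 2) @ \oo --> a ^+ 2.
  by rewrite expr2; under eq_fun do rewrite expr2; exact: cvgM.
have a3 : (fun n => `|x n.+1 - s| ^+ 2) @ \oo --> a ^+ 2 by have := a2; rewrite -cvg_shiftS.
have -> : 0 = a ^+ 2 - a ^+ 2 + (2 * B * 0 + 0 * 0) :> R by ring.
apply: cvgD; first exact: cvgB.
by apply: cvgD; apply: cvgM => //; exact: cvg_cst.
Qed.

Lemma gradient_cvg : (fun n => dg (x n)) @ \oo --> dg s.
Proof.
suff h : (fun n => dg (x n) - dg s) @ \oo --> (0 : H).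
  have -> : (fun n => dg (x n)) = (fun n => dg (x n) - dg s + dg s).
    by apply/funext => n; rewrite subrK.
  by rewrite -[X in _ --> X]add0r; apply: cvgD => //; exact: cvg_cst.
apply: (@cvg0_of_sqr_le _ _ _ (fun n => (lambda_low * kappa)^-1 * err n)).
  by rewrite -(mulr0 (lambda_low * kappa)^-1); apply: cvgM => //; exact: cvg_cst.
have lk : 0 < lambda_low * kappa := mulr_gt0 lambda_low_gt0 kappa_gt0.
move=> n; rewrite ler_pdivlMl//; have := descent_gap n.
have := mulr_ge0 (ltW lambda_low_gt0) (sqr_ge0 `|r n|); lra.
Qed.

Lemma residual_cvg : r @ \oo --> (0 : H).
Proof.
apply: (@cvg0_of_sqr_le _ _ _ (fun n => lambda_low^-1 * err n)).
  by rewrite -(mulr0 lambda_low^-1); apply: cvgM => //; exact: cvg_cst.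
move=> n; rewrite ler_pdivlMl//; have := descent_gap n.
have : 0 <= lambda_low * (kappa * `|dg (x n) - dg s| ^+ 2).
  by apply: mulr_ge0; [exact: ltW|apply: mulr_ge0; [exact: ltW|exact: sqr_ge0]].
lra.
Qed.

Lemma bounded_scale_cvg0 (c : nat -> R) (w : nat -> H) K : (forall n, `|c n| <= K) ->
  w @ \oo --> (0 : H) -> (fun n => c n *: w n) @ \oo --> (0 : H).
Proof.
move=> cK w0; apply/norm_cvg0P.
have K0 : 0 <= K by exact: le_trans (cK 0%N).
apply: (@squeeze_cvgr _ _ _ _ (cst 0) (fun n => K * `|w n|)).
- by apply: nearW => n; rewrite normr_ge0/= normrZ; apply: ler_wpM2r.
- exact: cvg_cst.
- rewrite -(mulr0 K); apply: cvgM; first exact: cvg_cst.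
  by rewrite -(@normr0 _ H); exact: cvg_norm.
Qed.

Lemma prox_gap_cvg : (fun n => x n - p n) @ \oo --> (0 : H).
Proof.
have -> : (fun n => x n - p n) = (fun n => r n + gamma n *: (dg (x n) - dg s)).
  by apply/funext => n; rewrite /r subrK.
rewrite -[X in _ --> X]addr0; apply: cvgD; first exact: residual_cvg.
apply: (@bounded_scale_cvg0 _ _ gamma_up).
  by move=> n; have /andP[h1 h2] := gamma_bounds n; rewrite ger0_norm// (le_trans _ h1)// ltW.
by rewrite -(subrr (dg s)); apply: cvgB; [exact: gradient_cvg|exact: cvg_cst].
Qed.

(** The gradients converge strongly and the vectors [p n] have the same weak limit
    as [x n]. Monotonicity inequalities pairing a strongly and a weakly convergent
    sequence survive in the limit, and maximality identifies that limit. *)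
Lemma weak_limit_optimal U l : UltraFilter U -> \oo `<=` U ->
  weak_limit ip U x l -> csub l (- dg l).
Proof.
move=> UU sU xl; have UP : ProperFilter U by exact: ultra_proper.
have toU (T : topologicalType) (a : T) (u : nat -> T) : u @ \oo --> a -> u @ U --> a.
  by move=> ua A nA; apply: sU; exact: ua.
have xK n : `|x n| <= B + `|s|.
  by have := ler_normD (x n - s) s; rewrite subrK => /le_trans; apply; rewrite lerD2r.
have pK n : `|p n| <= B + `|s|.
  have := ler_normD (p n - s) s; rewrite subrK => /le_trans; apply; rewrite lerD2r.
  exact: le_trans (p_bound n) (x_bound n).
(* Cocoercivity between [l] and [x n], in the limit. *)
have dgl : dg l = dg s.
  have c1 : (fun n => beta * ip (dg l - dg (x n)) (l - x n)) @ U --> beta * 0.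
    apply: cvgM; first exact: cvg_cst.
    have wd : (fun n => dg l - dg (x n)) @ U --> dg l - dg s.
      by apply: toU; apply: cvgB; [exact: cvg_cst|exact: gradient_cvg].
    have -> : (fun n => ip (dg l - dg (x n)) (l - x n))
      = (fun n => ip l (dg l - dg (x n)) - ip (x n) (dg l - dg (x n))).
      by apply/funext => n; rewrite [LHS]ipC ipDl ipNl.
    rewrite -(subrr (ip l (dg l - dg s))); apply: cvgB.
      exact: (ip_cvg ip_norm (cvg_cst l) wd).
    exact: weak_limit_strong xK xl wd.
  have c2 : (fun n => `|dg l - dg (x n)| ^+ 2) @ U --> `|dg l - dg s| ^+ 2.
    apply: toU; rewrite expr2; under eq_fun do rewrite expr2.
    by apply: cvgM; apply: cvg_norm; apply: cvgB;
      [exact: cvg_cst|exact: gradient_cvg|exact: cvg_cst|exact: gradient_cvg].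
  have := ler_cvg_to c2 c1; rewrite mulr0 => h.
  apply: (ip_vec_eq ip_norm); apply/eqP; rewrite eq_le ip_norm sqr_ge0 andbT.
  apply: h; apply: filterE => n.
  exact: (gradient_cocoercive ip_norm dg_gradient beta_gt0 dg_lipschitz g_Gamma0 l (x n)).
apply: (constrained_subgradient_maximal ip_norm C_nonempty C_closed C_convex f_Gamma0
  Cf_regular) => y w yw.
have pl : weak_limit ip U p l.
  move=> v; have -> : (fun n => ip (p n) v) = (fun n => ip (x n) v - ip (x n - p n) v).
    by apply/funext => n; rewrite ipDl ipNl; ring.
  rewrite -[X in _ --> X]subr0 -(ip0l ip v); apply: cvgB; first exact: xl.
  by apply: (ip_cvg ip_norm); [apply: toU; exact: prox_gap_cvg|exact: cvg_cst].
pose u n := (gamma n)^-1 *: (x n - gamma n *: dg (x n) - p n).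
have ucvg : u @ U --> - dg s.
  apply: toU; have -> : u = (fun n => (gamma n)^-1 *: r n - dg s).
    apply/funext => n; rewrite /u /r; have /andP[c0 _] := gamma_pos n.
    by apply: (ip_ext ip_norm) => v; rewrite ?(ipE ip); field; rewrite gt_eqF.
  rewrite -[X in _ --> X]add0r; apply: cvgB; last exact: cvg_cst.
  apply: (@bounded_scale_cvg0 _ _ gamma_low^-1); last exact: residual_cvg.
  move=> n; have /andP[h1 h2] := gamma_bounds n; have /andP[c0 _] := gamma_pos n.
  by rewrite ger0_norm ?invr_ge0 ?(ltW c0)// lef_pV2 ?posrE.
rewrite dgl.
have wu : (fun n => w - u n) @ U --> w - - dg s by apply: cvgB => //; exact: cvg_cst.
have lim : (fun n => ip (w - u n) (y - p n)) @ U --> ip (w - - dg s) (y - l).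
  have -> : (fun n => ip (w - u n) (y - p n)) = (fun n => ip y (w - u n) - ip (p n) (w - u n)).
    by apply/funext => n; rewrite [LHS]ipC ipDl ipNl.
  rewrite [ip _ (y - l)]ipC ipDl ipNl; apply: cvgB.
    exact: (ip_cvg ip_norm (cvg_cst y) wu).
  exact: weak_limit_strong pK pl wu.
apply: (cvgr_to_ge lim); apply: filterE => n.
exact: constrained_subgradient_monotone yw (p_csub n).
Qed.

End Residuals.

Lemma inexact_forward_backward_cvg : (exists s, csub s (- dg s)) ->
  exists2 l, csub l (- dg l) & weakly_converges ip x l.
Proof.
move=> [s ss]; apply: (opial ip_norm (K := `|x 0%N - s| + 2 + `|s|)).
- move=> n; have := ler_normD (x n - s) s; rewrite subrK => /le_trans; apply.
  by rewrite lerD2r; apply: (quasi_fejer_bounded (a := fun n => `|x n - s|)) => k;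
    exact: dist_step.
- move=> s' ss'; apply: quasi_fejer_cvg => n //; exact: dist_step.
- move=> U l UU sU xl; exact: (weak_limit_optimal ss UU sU xl).
Qed.

End InexactForwardBackward.

(** * The nested algorithm *)

Lemma step_size_bounds {R : realType} (gamma : nat -> R) (b : R) :
  (0 < ereal_inf (range (EFin \o gamma)))%E ->
  (ereal_sup (range (EFin \o gamma)) < b%:E)%E ->
  exists lo up, [/\ 0 < lo, up < b & forall n, lo <= gamma n <= up].
Proof.
set i := ereal_inf _; set s := ereal_sup _ => i0 sb.
have ig n : (i <= (gamma n)%:E)%E by apply: ereal_inf_lbound; exists n.
have gs n : ((gamma n)%:E <= s)%E by apply: ereal_sup_ubound; exists n.
have fi : i \is a fin_num.
  by rewrite fin_real// (lt_trans _ i0)// (le_lt_trans (ig 0%N)) ?ltry.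
have fs : s \is a fin_num.
  by rewrite fin_real// (lt_le_trans _ (gs 0%N)) ?ltNyr// (lt_trans sb) ?ltry.
exists (fine i), (fine s); split.
- by rewrite -lte_fin fineK.
- by rewrite -lte_fin fineK.
- by move=> n; rewrite -!lee_fin !fineK// ig gs.
Qed.

Section InnerIterates.
Context {R : realType} {H : completeNormedModType R} (ip : {dot H for (@idfun R)}).
Hypothesis ip_norm : induces_norm ip.

Lemma nested_sequence_in_set (C : set H) (f : H -> \bar R) (dg : H -> H)
    (gamma lambda : nat -> R) (tau : nat -> nat -> R) x0 M x :
  C !=set0 -> closed C -> convex_set C -> (forall n, 0 < lambda n <= 1) -> C x0 ->
  nested_sequence C f dg gamma lambda tau x0 M x -> forall n, C (x n).
Proof.
move=> C0 Ccl Ccv lP Cx0 [xE xS]; elim=> [|n ih]; first by rewrite xE.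
have [z [zh [mn [_ _ zP _ ->]]]] := xS n.
have Cq : C (zh mn).
  have [-> _] := zP mn (leqnn _).
  exact: (proj_normal_cone ip_norm _ C0 Ccl Ccv).1.
have /andP[l0] := lP n; rewrite le_eqVlt => /predU1P[->|l1].
  by rewrite scale1r addrC subrK.
have -> : x n + lambda n *: (zh mn - x n) = lambda n *: zh mn + (1 - lambda n) *: x n.
  by vec ip ip_norm.
by apply: convex_setP; rewrite ?l0.
Qed.

End InnerIterates.

Theorem proposition4p2 (R : realType) (H : completeNormedModType R)
    (ip : {dot H for (@idfun R)})
    (ip_norm : induces_norm ip)
    (H_separable : separable_space H)
    (C : set H) (C_nonempty : C !=set0) (C_closed : closed C)
    (C_convex : convex_set C)
    (f : H -> \bar R) (f_Gamma0 : Gamma0 f)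
    (g : H -> R) (g_Gamma0 : Gamma0 (EFin \o g))
    (dg : H -> H) (dg_gradient : is_gradient ip g dg)
    (beta : R) (beta_gt0 : 0 < beta) (dg_lipschitz : beta.-lipschitz dg)
    (has_solution : exists x, is_minimizer C (fun y => (f y + (g y)%:E)%E) x)
    (qualification :
      [\/ C `&` (dom f)° !=set0,
          dom f `&` C° !=set0
        | finite_dimensional H /\ rint C `&` rint (dom f) !=set0])
    (gamma : nat -> R)
    (gamma_inf : (0 < ereal_inf (range (EFin \o gamma)))%E)
    (gamma_sup : (ereal_sup (range (EFin \o gamma)) < (2 * beta^-1)%:E)%E)
    (lambda : nat -> R) (lambda_low : R) (lambda_low_gt0 : 0 < lambda_low)
    (lambda_bounds : forall n, lambda_low <= lambda n <= 1)
    (tau_low : R) (tau_low_bounds : 0 < tau_low <= 2)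
    (tau : nat -> nat -> R)
    (tau_bounds : forall n m, tau_low <= tau n m <= 2)
    (x0 : H) (x0C : C x0) :
  (exists Mbar : nat -> nat,
     (forall n, (1 <= Mbar n)%N) /\
     forall (M : nat -> nat) (x : nat -> H),
       (forall n, (Mbar n <= M n)%N) ->
       nested_sequence C f dg gamma lambda tau x0 M x ->
       exists2 xs, is_minimizer C (fun y => (f y + (g y)%:E)%E) xs
                 & weakly_converges ip x xs)
  /\
  (forall (M : nat -> nat) (x : nat -> H),
     (forall n, (1 <= M n)%N) ->
     nested_sequence C f dg gamma lambda tau x0 M x ->
     forall n, C (x n)).

Proof.
have lambdaP n : 0 < lambda n <= 1.
  by have /andP[h1 ->] := lambda_bounds n; rewrite (lt_le_trans lambda_low_gt0 h1).
split; last first.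
  move=> M x _; exact: (nested_sequence_in_set ip_norm C_nonempty C_closed C_convex
    lambdaP x0C).
have reg := qualification_regular ip_norm qualification.
have [glo [gup [glo0 gup2 gammaP]]] := step_size_bounds gamma_inf gamma_sup.
have [s smin] := has_solution.
have ss := minimizer_optimality ip_norm C_nonempty C_closed C_convex f_Gamma0 reg
  dg_gradient dg_lipschitz smin.
have g0 n : 0 < gamma n by have /andP[h _] := gammaP n; exact: lt_le_trans h.
have g2 n : 0 < gamma n < 2 / beta.
  by rewrite g0/=; have /andP[_ h] := gammaP n; exact: le_lt_trans gup2.
have tl0 : 0 < tau_low by case/andP: tau_low_bounds.
(* The errors [2^-1 ^+ n] sum up to 2, so the iterates never leave this ball. *)
pose rho := `|x0 - s| + 2 + `|s|.
have e0 n : 0 < (2^-1 : R) ^+ n by rewrite exprn_gt0// invr_gt0.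
have /choice[Mbar MbarP] n : exists J, (0 < J)%N /\ forall M x x1, (J <= M)%N ->
    `|x| <= rho -> outer_step C f dg gamma lambda tau n M x x1 ->
    exists p q, [/\ constrained_subgradient ip C f p
        ((gamma n)^-1 *: (x - gamma n *: dg x - p)),
      `|q - p| <= 2^-1 ^+ n & x1 = x + lambda n *: (q - x)].
  have [J J0 hJ] := outer_step_uniform ip_norm C_nonempty C_closed C_convex f_Gamma0 reg
    beta_gt0 dg_lipschitz lambda rho (erefl (gamma n)) (g0 n) tl0 (tau_bounds n) (e0 n).
  by exists J.
exists Mbar; split=> [n|M x MbarM [xE xS]]; first by have [] := MbarP n.
have rho_of n : `|x n - s| <= `|x0 - s| + 2 -> `|x n| <= rho.
  by have := ler_normD (x n - s) s; rewrite subrK => h1 h2; rewrite (le_trans h1)// lerD2r.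
(* Staying in the ball and having small errors are proved together: the term
   [2 * 2^-1 ^+ n] is the sum of the errors to come. *)
have x_bound n : `|x n - s| + 2 * 2^-1 ^+ n <= `|x0 - s| + 2.
  elim: n => [|n ih]; first by rewrite xE expr0 mulr1.
  have xr : `|x n| <= rho by apply: rho_of; have := e0 n; lra.
  have [p [q [hp hq ->]]] := (MbarP n).2 _ _ _ (MbarM n) xr (xS n).
  have lP : 0 <= lambda n <= 1 by have /andP[/ltW-> ->] := lambdaP n.
  have := inexact_step ip_norm g_Gamma0 dg_gradient beta_gt0 dg_lipschitz (g2 n) lP ss hp hq.
  by rewrite exprS mulrA mulfV// mul1r; lra.
have /choice[pq pqP] n : exists pq : H * H,
    [/\ constrained_subgradient ip C f pq.1
        ((gamma n)^-1 *: (x n - gamma n *: dg (x n) - pq.1)),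
      `|pq.2 - pq.1| <= 2^-1 ^+ n & x n.+1 = x n + lambda n *: (pq.2 - x n)].
  have xr : `|x n| <= rho by apply: rho_of; have := e0 n; have := x_bound n; lra.
  have [p [q h]] := (MbarP n).2 _ _ _ (MbarM n) xr (xS n).
  by exists (p, q).
have [l hl xl] := inexact_forward_backward_cvg ip_norm C_nonempty C_closed C_convex f_Gamma0
  reg g_Gamma0 dg_gradient beta_gt0 dg_lipschitz glo0 gup2 gammaP lambda_low_gt0 lambda_bounds
  (p := fun n => (pq n).1) (q := fun n => (pq n).2)
  (fun n => let: And3 h _ _ := pqP n in h) (fun n => let: And3 _ h _ := pqP n in h)
  (fun n => let: And3 _ _ h := pqP n in h) (ex_intro _ s ss).
exists l => //.
exact: (optimality_minimizer ip_norm f_Gamma0 g_Gamma0 dg_gradient dg_lipschitz hl).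
Qed.
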